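(* Fix $p\in(0,1)$ and let $q=1-p$. (a) ($\epsilon$-fractional loss.) There exist constants $\epsilon_0,c_1>0$ such that for every $0<\epsilon<\epsilon_0$, all sufficiently large $n$, and every integer $d$ satisfying $$d\ge\frac{\log(1/\epsilon)+c_1\log\log(1/\epsilon)}{\log(1/q)},$$ a random graph $G\sim\mathcal G(n,n,d)$ satisfies $$\mathbb P_G\{L_{\mathcal D}(G)\le\epsilon n\}\ge 1-\frac1n\qquad\text{for all }\mathcal D\in\mathfrak B(p).$$ (b) (Constant loss.) For every fixed $\delta>0$ and $\ell\ge 64/\delta+2/p$, all sufficiently large $n$, and every integer $d$ satisfying $$d\ge\frac{(1+\delta)\log n}{\log(1/q)},$$ a random graph $G\sim\mathcal G(n,n,d)$ satisfies $$\mathbb P_G\{L_{\mathcal D}(G)\le\ell\}\ge 1-\frac1n\qquad\text{for all }\mathcal D\in\mathfrak B(p).$$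
   Context: Bipartite (multi)graphs $G$ have $n$ supply nodes (left) and $n$ demand nodes (right); $E$ is the set of pairs (supply $i$, demand $j$) joined by at least one edge. For $D\in\mathbb R_{\ge0}^n$ define $$z(G,D)=\max_{x_{ij}\ge 0}\ \sum_{(i,j)\in E}x_{ij}\quad\text{s.t.}\quad \sum_{j:(i,j)\in E}x_{ij}\le 1\ \ (i\in[n]),\qquad \sum_{i:(i,j)\in E}x_{ij}\le D_j\ \ (j\in[n]).$$ Let $K_{n,n}$ be the complete bipartite graph, $L(G,D)=z(K_{n,n},D)-z(G,D)$, and for a demand distribution $\mathcal D$ let $L_{\mathcal D}(G)=\mathbb E_{D\sim\mathcal D}[L(G,D)]$ (expectation over $D$ only, $G$ fixed). $\mathcal G(n,n,d)$ (bipartite configuration model): attach $d$ half-edges to each vertex in either partition, pair the $nd$ left half-edges with the $nd$ right half-edges uniformly at random, and merge each pair into an edge (multi-edges allowed). $\mathfrak B(p)$ is the set of all probability distributions of random vectors $D=(D_1,\dots,D_n)$ on $\mathbb R^n$ with every coordinate $D_i$ supported on $[0,1/p]$; the coordinates may be non-identically distributed and arbitrarily dependent. ''Sufficiently large $n$'' depends only on the fixed parameters ($p,\epsilon$ in (a); $p,\delta,\ell$ in (b)). *)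

(* Defs.v *)
From HB Require Import structures.
From mathcomp Require Import all_boot all_order all_algebra all_fingroup.
From mathcomp Require Import all_classical all_reals all_analysis.

Set Implicit Arguments.
Unset Strict Implicit.
Unset Printing Implicit Defensive.

Import Order.TTheory GRing.Theory Num.Theory.
Local Open Scope classical_set_scope.
Local Open Scope ring_scope.

(* [G i j] is the number of parallel edges between supply node [i] and demand
   node [j]. *)
Definition bimultigraph (n : nat) : Type := 'M[nat]_n.

Definition adjacent (n : nat) (G : bimultigraph n) (i j : 'I_n) : bool :=
  (0 < G i j)%N.

Definition complete_bigraph (n : nat) : bimultigraph n := const_mx 1%N.

Definition feasible_flow (R : realType) (n : nat) (G : bimultigraph n)
    (D : n.-tuple R) (x : 'M[R]_n) : Prop :=
  [/\ forall i j, 0 <= x i j,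
      forall i, \sum_(j < n | adjacent G i j) x i j <= 1
    & forall j, \sum_(i < n | adjacent G i j) x i j <= tnth D j].

Definition flow_value (R : realType) (n : nat) (G : bimultigraph n)
    (x : 'M[R]_n) : R :=
  \sum_(i < n) \sum_(j < n | adjacent G i j) x i j.

(* For [D >= 0] the values form a nonempty compact set (projected onto the
   coordinates in [E], the feasible flows form a polytope), so the supremum is
   the maximum of the linear program. If some [D_j < 0] the program is
   infeasible and the value is [sup set0 = 0]. *)
Definition max_flow (R : realType) (n : nat) (G : bimultigraph n)
    (D : n.-tuple R) : R :=
  sup [set flow_value G x | x in feasible_flow G D].

Definition loss (R : realType) (n : nat) (G : bimultigraph n)
    (D : n.-tuple R) : R :=
  max_flow (complete_bigraph n) D - max_flow G D.

(* Distributions on [R^n] are the probability measures on the product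
   sigma-algebra of the Borel sigma-algebra of [R]. *)
Definition demand_distribution (R : realType) (n : nat) : Type :=
  probability (n.-tuple (measurableTypeR R)) R.

Definition expected_loss (R : realType) (n : nat)
    (mu : demand_distribution R n) (G : bimultigraph n) : \bar R :=
  ('E_mu [@loss R n G])%E.

(* The class B(p): marginals supported on [0, 1/p], with no assumption on the
   joint law. *)
Definition demand_class (R : realType) (n : nat) (p : R)
    (mu : demand_distribution R n) : Prop :=
  forall j : 'I_n,
    mu [set D : n.-tuple (measurableTypeR R) | 0 <= tnth D j <= 1 / p] = 1%E.

(* A half-edge is a pair (vertex, label); a perfect matching between left and
   right half-edges is a permutation [s] of ['I_n * 'I_d], where the left
   half-edge [h] is paired with the right half-edge [s h]. *)
Definition configuration_graph (n d : nat) (s : {perm 'I_n * 'I_d}) :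
    bimultigraph n :=
  \matrix_(i < n, j < n) #|[set a : 'I_d | (s (i, a)).1 == j]%SET|.

(* Probability of an event when the pairing is uniform. *)
Definition configuration_prob (R : realType) (n d : nat)
    (A : pred (bimultigraph n)) : R :=
  #|[set s : {perm 'I_n * 'I_d} | A (configuration_graph s)]%SET|%:R
    / #|[set: {perm 'I_n * 'I_d}]%SET|%:R.

(* Main.v *)
Require Import Defs.
From HB Require Import structures.
From mathcomp Require Import all_boot all_order all_algebra all_fingroup.
From mathcomp Require Import all_classical all_reals all_analysis.
From mathcomp Require Import measurable_realfun ring lra.

Set Implicit Arguments.
Unset Strict Implicit.
Unset Printing Implicit Defensive.

Import Order.TTheory GRing.Theory Num.Theory.
Local Open Scope classical_set_scope.
Local Open Scope ring_scope.

(* By max-flow min-cut, the loss exceeds t only if some set A of supply nodes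
   has neighbours of total demand less than min(n, sum D) - n + #|A| - t. For a
   fixed demand vector D we bound the expected number of such A over the random
   pairing. Revealing the half-edges of A one at a time, each hits a fresh
   demand node with conditionally uniform probability, which gives a Chernoff
   bound lam^a (1 - p (1 - 1/lam) (1 - a/n))^(a d) for a single A of size a.
   It beats the binomial C(n, a) when a <= n/2: with lam = ln (1/eps) or
   lam = ln n its base is about (n/a) q^d for a <= n/lam, and it is
   exponentially small in d beyond. When #|A| > n/2 the missed demand nodes form
   a set B of at least p (n - a) nodes whose neighbours all lie outside A, which
   has probability at most (1 - a/n)^(#|B| d). The resulting bound n^-2, uniform
   in D, is transferred to the expected loss by exchanging the two expectations
   and by Markov's inequality. *)

(** * Max-flow min-cut *)

Lemma sum_indic (R : nmodType) (I : finType) (P : pred I) (i : I) (x : R) :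
  \sum_(k | P k) (if k == i then x else 0) = if P i then x else 0.
Proof.
rewrite -big_mkcondr /=; case: ifP => Pi.
  by rewrite (big_pred1 i) // => k; rewrite /= andbC; case: eqP => // ->.
by rewrite big1 // => k /andP[Pk /eqP ki]; move: Pk; rewrite ki Pi.
Qed.

Section Transport.
Variables (R : realFieldType) (I J : finType).
Implicit Types (A : {set I}) (B : {set J}) (E : {set I * J}) (C : {set I} * {set J}) (c : I -> R) (D : J -> R).

Definition edgeless E C : bool :=
  [forall i in C.1, forall j in C.2, (i, j) \notin E].

Lemma edgelessP E C :
  reflect (forall i j, i \in C.1 -> j \in C.2 -> (i, j) \notin E) (edgeless E C).
Proof.
apply: (iffP forall_inP) => [h i j iC jC|h i iC].
  by have /forall_inP/(_ _ jC) := h i iC.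
by apply/forall_inP => j jC; exact: h.
Qed.

(** If [C] is edgeless, the nodes outside it form a vertex cover; [cut] is its weight, the capacity
    of the corresponding source-sink cut. *)
Definition cut c D C : R :=
  \sum_(i | i \notin C.1) c i + \sum_(j | j \notin C.2) D j.

(** Every node is counted equally often on both sides, so submodularity is an equality here. Union
    on one side goes with intersection on the other because this uncrossing keeps pairs edgeless. *)
Lemma cut_submod c D (A A' : {set I}) (B B' : {set J}) :
  cut c D (A, B) + cut c D (A', B')
  = cut c D (A :|: A', B :&: B') + cut c D (A :&: A', B :|: B').
Proof.
have split2 (T : finType) (f : T -> R) (X Y : {set T}) :
    \sum_(i | i \notin X) f i + \sum_(i | i \notin Y) f i
    = \sum_(i | i \notin X :|: Y) f i + \sum_(i | i \notin X :&: Y) f i.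
  rewrite !(big_mkcond (fun i => i \notin _)) -!big_split /=.
  apply: eq_bigr => i _; rewrite !inE.
  by case: (i \in X); case: (i \in Y); rewrite //= ?addr0 ?add0r.
have := split2 _ c A A'; have := split2 _ D B B'.
rewrite /cut /=; lra.
Qed.

Lemma cutD1l c D A B i :
  i \in A -> cut c D (A :\ i, B) = cut c D (A, B) + c i.
Proof.
move=> iA; rewrite /cut /= (bigD1 i) ?setD11//= (eq_bigl (fun k => k \notin A)).
  by rewrite [in RHS]addrC addrA.
move=> k; rewrite !inE negb_and negbK; case: (eqVneq k i) => [->|] /=.
  by rewrite iA.
by rewrite andbT.
Qed.

Lemma cutD1r c D A B j :
  j \in B -> cut c D (A, B :\ j) = cut c D (A, B) + D j.
Proof.
move=> jB; rewrite /cut /= -addrA; congr (_ + _).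
rewrite (bigD1 j) ?setD11//= (eq_bigl (fun k => k \notin B)) 1?addrC//.
move=> k; rewrite !inE negb_and negbK; case: (eqVneq k j) => [->|] /=.
  by rewrite jB.
by rewrite andbT.
Qed.

(** Residual capacities once [x] units have been sent through node [k]. *)
Definition shift1 (T : finType) (f : T -> R) (k : T) (x : R) : T -> R :=
  fun l => f l - (if l == k then x else 0).

Lemma cut_shift c D i j x A B :
  cut (shift1 c i x) (shift1 D j x) (A, B)
  = cut c D (A, B) - (if i \notin A then x else 0)
    - (if j \notin B then x else 0).
Proof.
rewrite /cut /shift1 /= !sumrB !sum_indic.
by case: (i \notin A); case: (j \notin B); lra.
Qed.

(* Induction on the edges: the amount [x] sent along the edge [(i, j)] has to
   dominate [v - cut] for the cuts that become admissible once [(i, j)] is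
   deleted, and be dominated by [cut - v] for the cuts that lose [x] twice;
   submodularity makes these requirements compatible. *)
Lemma max_flow_min_cut E c D (v : R) :
  (forall i, 0 <= c i) -> (forall j, 0 <= D j) ->
  (forall C, edgeless E C -> v <= cut c D C) ->
  exists x : I -> J -> R,
    [/\ forall i j, 0 <= x i j, forall i j, (i, j) \notin E -> x i j = 0,
        forall i, \sum_j x i j <= c i, forall j, \sum_i x i j <= D j
      & v <= \sum_i \sum_j x i j].
Proof.
elim: {E}_.+1 {-2}E (ltnSn #|E|) c D v => // m IH E.
rewrite ltnS => Em c D v c0 D0 vcut.
have [E0|[[i j] ijE]] := set_0Vmem E.
  (* Without edges the full pair is edgeless with cut [0], so [v <= 0] and the zero flow is
     enough. *)
  exists (fun _ _ => 0); split=> // [i|j|]; rewrite ?big1//.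
  apply: le_trans (vcut ([set: I]%SET, [set: J]%SET) _) _.
    by apply/edgelessP => i j _ _; rewrite E0 inE.
  rewrite /cut /= !big_pred0 ?addr0// => k; by rewrite inE.
pose P C :=
  [&& i \in C.1, j \in C.2 & edgeless (E :\ (i, j)) C].
pose x := \big[Num.max/0]_(C | P C) (v - cut c D C).
have x0 : 0 <= x by exact: bigmax_ge_id.
have lex C : P C -> v - cut c D C <= x by move=> PC; exact: le_bigmax_cond.
have edgeW A B : edgeless (E :\ (i, j)) (A, B) -> (i \notin A) || (j \notin B) ->
    edgeless E (A, B).
  move=> /edgelessP h ijAB; apply/edgelessP => k l kA lB.
  have := h k l kA lB; rewrite !inE negb_and negbK => /orP[/eqP[ki lj]|//].
  by move: ijAB kA lB; rewrite ki lj /= => /orP[] /negbTE ->.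
(* Dropping [i] from [A] makes the pair edgeless in [E] again and raises its cut by [c i]. *)
have x_c : x <= c i.
  apply: bigmax_le => //= -[A B] /and3P[/= iA jB eAB].
  have := vcut (A :\ i, B); rewrite cutD1l// => h; rewrite lerBlDl; apply: h.
  apply: edgeW; rewrite ?setD11//; apply/edgelessP => k l /= /setD1P[_ kA] lB.
  by move/edgelessP: eAB => /(_ k l kA lB).
have x_D : x <= D j.
  apply: bigmax_le => //= -[A B] /and3P[/= iA jB eAB].
  have := vcut (A, B :\ j); rewrite cutD1r// => h; rewrite lerBlDl; apply: h.
  apply: edgeW; rewrite ?setD11 ?orbT//.
  apply/edgelessP => k l /= kA /setD1P[_ lB].
  by move/edgelessP: eAB => /(_ k l kA lB).
(* Only [(i, j)] can join [A] to [B], and [(A', B')] avoids both endpoints; hence both uncrossed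
   pairs are edgeless in [E], and their two cut bounds add up to the claim. *)
have x_cut A' B' : i \notin A' -> j \notin B' -> edgeless E (A', B') ->
    x <= cut c D (A', B') - v.
  move=> iA' jB' eAB'; apply: bigmax_le => [|[A B] /and3P[/= iA jB eAB]].
    by rewrite subr_ge0 vcut.
  have h1 : v <= cut c D (A :|: A', B :&: B').
    apply: vcut; apply: edgeW; last by rewrite !inE (negbTE jB') andbF orbT.
    apply/edgelessP => k l /= /setUP[kA|kA'] /setIP[lB lB'].
      by move/edgelessP: eAB => /(_ k l kA lB).
    by move/edgelessP: eAB' => /(_ k l kA' lB'); rewrite !inE => /negbTE ->; rewrite andbF.
  have h2 : v <= cut c D (A :&: A', B :|: B').
    apply: vcut; apply: edgeW; last by rewrite !inE (negbTE iA') andbF.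
    apply/edgelessP => k l /= /setIP[kA kA'] /setUP[lB|lB'].
      by move/edgelessP: eAB => /(_ k l kA lB).
    by move/edgelessP: eAB' => /(_ k l kA' lB'); rewrite !inE => /negbTE ->; rewrite andbF.
  by have := cut_submod c D A A' B B'; lra.
have [|||C eC|y [y0 yE yc yD yv]] :=
    IH (E :\ (i, j)) _ (shift1 c i x) (shift1 D j x) (v - x).
- by move: Em; rewrite (cardsD1 (i, j)) ijE.
- by move=> k; rewrite /shift1; case: eqP => [->|]; rewrite ?subr_ge0 ?subr0.
- by move=> k; rewrite /shift1; case: eqP => [->|]; rewrite ?subr_ge0 ?subr0.
- case: C eC => A B eC; rewrite cut_shift.
  (* The cut loses [0], [x], [x] or [2 x] while the target loses [x]; [lex] and [x_cut] settle the
     two extreme cases. *)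
  have [iA|iA] := boolP (i \in A); have [jB|jB] := boolP (j \in B) => /=.
  + by have := lex (A, B); rewrite /P /= iA jB eC => /(_ isT); lra.
  + have := vcut _ (edgeW _ _ eC _); rewrite jB orbT => /(_ isT); lra.
  + have := vcut _ (edgeW _ _ eC _); rewrite iA => /(_ isT); lra.
  + have := edgeW _ _ eC; rewrite iA => /(_ isT) /(x_cut _ _ iA jB); lra.
exists (fun k l => y k l + (if (k, l) == (i, j) then x else 0)).
have pairE k l : (if (k, l) == (i, j) then x else 0)
    = if l == j then (if k == i then x else 0) else 0.
  by rewrite xpair_eqE andbC; case: (l == j).
have pairE' k l : (if (k, l) == (i, j) then x else 0)
    = if k == i then (if l == j then x else 0) else 0.
  by rewrite xpair_eqE; case: (k == i).
split=> [k l|k l klE|k|l|].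
- by rewrite addr_ge0//; case: ifP.
- rewrite yE ?inE ?(negbTE klE) ?andbF//.
  by case: eqP klE => [->|]; rewrite ?ijE// addr0.
- rewrite big_split /= (eq_bigr _ (fun l _ => pairE k l)) sum_indic /=.
  by have := yc k; rewrite /shift1; case: (k == i); lra.
- rewrite big_split /= (eq_bigr _ (fun k _ => pairE' k l)) sum_indic /=.
  by have := yD l; rewrite /shift1; case: (l == j); lra.
- rewrite (eq_bigr (fun k => \sum_l y k l + (if k == i then x else 0))).
    by rewrite big_split /= sum_indic; lra.
  by move=> k _; rewrite big_split /= (eq_bigr _ (fun l _ => pairE k l)) sum_indic.
Qed.

End Transport.

(** * Sampling half-edges without replacement *)

Section Sampling.
Variables (R : realFieldType) (n d : nat).
Implicit Types (s : {perm 'I_n * 'I_d}) (X : {set 'I_n * 'I_d}) (N : {set 'I_n}).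

Definition hit s X : {set 'I_n} := [set (s h).1 | h in X]%SET.

Lemma hit_tperm s X h h' : h \notin X -> h' \notin X ->
  hit (tperm h h' * s)%g X = hit s X.
Proof.
move=> hX h'X; apply: eq_in_imset => k kX; rewrite permM tpermD//.
  by apply: contraNneq hX => ->.
by apply: contraNneq h'X => ->.
Qed.

(* Conditionally on the values of [s] on [X], the value [s h] is uniform on
   the complement of [s @: X]. *)
Lemma sum_perm_fresh X h (f : {set 'I_n} -> 'I_n * 'I_d -> R) : h \notin X ->
  #|~: X|%:R * (\sum_s f (hit s X) (s h))
  = \sum_s \sum_(h' | h' \notin X) f (hit s X) (s h').
Proof.
move=> hX; rewrite exchange_big /= mulr_natl.
rewrite -sumr_const; apply: eq_big => [h'|h']; first by rewrite inE.
rewrite inE => h'X.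
rewrite [RHS](reindex_inj (@mulgI _ (tperm h h'))) /=.
by apply: eq_bigr => s _; rewrite hit_tperm// permM tpermR.
Qed.

Variables (w : 'I_n -> R) (F : pred {set 'I_n}) (k : R).
Hypotheses (w01 : forall j, 0 <= w j <= 1) (k01 : 0 <= k <= 1).
Hypothesis F_down : forall N N', N \subset N' -> F N' -> F N.
Hypothesis F_mass : forall N, F N -> n%:R * k <= \sum_(j | j \notin N) (1 - w j).

(** Half-edges in [X] end at nodes already hit and carry no gain [g]. So the unrevealed ones, at
    most [n * d] in number, carry the whole gain, which is at least [d * n * k] by [F_mass]. *)
Lemma sum_fresh_le s X : F (hit s X) ->
  \sum_(h | h \notin X) (if (s h).1 \in hit s X then 1 else w (s h).1)
    <= #|~: X|%:R * (1 - k).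
Proof.
move=> FX; pose g j := if j \in hit s X then 0 else 1 - w j.
have g0 j : 0 <= g j.
  by rewrite /g; case: ifP; rewrite // subr_ge0; case/andP: (w01 j).
rewrite (eq_bigr (fun h => 1 - g (s h).1)); last first.
  by move=> h _; rewrite /g; case: ifP; lra.
rewrite sumrB sumr_const -[X in X - _]/(#|[predC X]|%:R).
rewrite (_ : #|[predC X]| = #|~: X|); last by apply: eq_card => h; rewrite !inE.
suff : #|~: X|%:R * k <= \sum_(h | h \notin X) g (s h).1 by lra.
have -> : \sum_(h | h \notin X) g (s h).1 = \sum_h g (s h).1.
  rewrite [RHS](bigID (fun h => h \notin X)) /= [X in _ + X]big1 ?addr0// => h.
  by rewrite negbK => hX; rewrite /g (_ : _ \in _ = true)//; apply/imsetP; exists h.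
have -> : \sum_h g (s h).1 = \sum_(h : 'I_n * 'I_d) g h.1.
  by rewrite [RHS](reindex_inj (@perm_inj _ s)).
rewrite -(pair_bigA _ (fun j _ => g j)) /=.
under eq_bigr do rewrite sumr_const card_ord -mulr_natl.
rewrite -mulr_sumr.
have := F_mass FX; rewrite big_mkcond /=.
rewrite (eq_bigr g) => [mass|j _]; last by rewrite /g; case: (j \in _).
apply: le_trans (ler_wpM2l (ler0n _ d) mass).
rewrite mulrA ler_wpM2r//; first by case/andP: k01.
rewrite -natrM ler_nat mulnC; apply: leq_trans (max_card _) _.
by rewrite card_prod !card_ord.
Qed.

(** The product is killed once [F] fails, since [F_mass] gives decay only while [F] holds. *)
Definition hit_weight s X : R :=
  if F (hit s X) then \prod_(j in hit s X) w j else 0.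

Lemma hit_weight_ge0 s X : 0 <= hit_weight s X.
Proof.
rewrite /hit_weight; case: ifP => // _; apply: prodr_ge0 => j _.
by case/andP: (w01 j).
Qed.

Lemma hit_weightU1 s X h : hit_weight s (h |: X) <=
  hit_weight s X * (if (s h).1 \in hit s X then 1 else w (s h).1).
Proof.
rewrite /hit_weight.
have -> : hit s (h |: X) = (s h).1 |: hit s X by rewrite /hit imsetU1.
case: ifP => FhX; last first.
  rewrite mulr_ge0//; first exact: hit_weight_ge0.
  by case: ifP; rewrite ?ler01//; case/andP: (w01 (s h).1).
have -> : F (hit s X) by apply: F_down FhX; apply: finset.subsetUr.
case: ifP => [hX|/negbT hX]; last by rewrite big_setU1// mulrC.
by rewrite mulr1 (finset.setUidPr _)// finset.sub1set.
Qed.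

(** A supermartingale argument: by [sum_perm_fresh] and [sum_fresh_le], revealing one more half-edge
    multiplies the mean weight by at most [1 - k]. *)
Lemma sum_hit_weight X :
  \sum_s hit_weight s X <= #|{perm 'I_n * 'I_d}|%:R * (1 - k) ^+ #|X|.
Proof.
have k1 : 0 <= 1 - k by rewrite subr_ge0; case/andP: k01.
elim: {X}#|X| {-2}X (erefl #|X|) => [|m IH] X Xm.
  rewrite Xm expr0 mulr1 -sum1_card natr_sum; apply: ler_sum => s _.
  rewrite /hit_weight; case: ifP => _ //; apply: prodr_ile1 => j _; exact: w01.
have [h hX] : exists h, h \in X by apply/card_gt0P; rewrite Xm.
set Y := X :\ h.
have Ym : #|Y| = m by move: Xm; rewrite (cardsD1 h) hX => -[].
have hY : h \notin Y by rewrite /Y !inE eqxx.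
have Y0 : 0 < #|~: Y|%:R :> R.
  by rewrite ltr0n; apply/card_gt0P; exists h; rewrite inE.
rewrite -(ler_pM2l Y0) Xm exprSr.
apply: (@le_trans _ _ (\sum_s hit_weight s Y * (#|~: Y|%:R * (1 - k)))).
  pose f N (v : 'I_n * 'I_d) := (if F N then \prod_(j in N) w j else 0) *
    (if v.1 \in N then 1 else w v.1) : R.
  apply: (@le_trans _ _ (#|~: Y|%:R * \sum_s f (hit s Y) (s h))).
    rewrite ler_pM2l//; apply: ler_sum => s _.
    by rewrite -{1}(finset.setD1K hX); exact: hit_weightU1.
  rewrite sum_perm_fresh//; apply: ler_sum => s _.
  rewrite /f -mulr_sumr /hit_weight.
  case: ifP => [Fs|]; last by rewrite !mul0r.
  apply: ler_wpM2l; last exact: sum_fresh_le.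
  by apply: prodr_ge0 => j _; case/andP: (w01 j).
rewrite -mulr_suml mulrC -[leLHS]mulrA ler_pM2l// [leLHS]mulrC.
by rewrite mulrA ler_wpM2r//; have := IH Y Ym; rewrite Ym.
Qed.

End Sampling.

(** * Chernoff bounds for a fixed set of supply nodes *)

(** Convexity, obtained by averaging the tangent at [y * z], evaluated at [0] and [z], with weights
    [1 - y] and [y]. *)
Lemma expR_le_chord (R : realType) (y z : R) : 0 <= y <= 1 ->
  expR (y * z) <= 1 - y + y * expR z.
Proof.
move=> /andP[y0 y1].
have tangent x : expR (y * z) * (1 + (x - y * z)) <= expR x.
  have := expR_ge1Dx (x - y * z); rewrite -(ler_pM2l (expR_gt0 (y * z))).
  by rewrite -expRD [y * z + _]addrC subrK.
have := tangent 0; have := tangent z; rewrite expR0.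
set E := expR (y * z) => h1 h2.
have : (1 - y) * (E * (1 + (0 - y * z))) <= (1 - y) * 1.
  by rewrite ler_wpM2l// subr_ge0.
have : y * (E * (1 + (z - y * z))) <= y * expR z by rewrite ler_wpM2l.
have -> : E = (1 - y) * (E * (1 + (0 - y * z))) + y * (E * (1 + (z - y * z))).
  by ring.
lra.
Qed.

Lemma card_ord_set n (A : {set 'I_n}) : (#|A| <= n)%N.
Proof. by rewrite -[leqRHS]card_ord max_card. Qed.

Lemma card_ratio_itv (R : realFieldType) n (A : {set 'I_n}) :
  0 <= (#|A|%:R / n%:R : R) <= 1.
Proof.
case: n A => [|n] A; first by rewrite invr0 mulr0 lexx ler01.
by rewrite divr_ge0//= ler_pdivrMr ?ltr0n// mul1r ler_nat card_ord_set.
Qed.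

Section Shortfall.
Variables (R : realType) (n d : nat) (p : R).
Implicit Types (A B N T : {set 'I_n}) (s : {perm 'I_n * 'I_d}) (D : 'I_n -> R).

Definition half_edges A : {set 'I_n * 'I_d} := finset.setX A [set: 'I_d]%SET.

Lemma card_half_edges A : #|half_edges A| = (#|A| * d)%N.
Proof. by rewrite /half_edges finset.cardsX finset.cardsT card_ord. Qed.

(* With [c = #|A| - t] and [N] the neighbours of [A], this says that the cut
   defined by [A] is below [minr n (\sum_j D j)] by more than [t]. *)
Definition shortfall D N (c : R) : bool :=
  (\sum_(j in N) D j < c) && (\sum_(j in N) D j + n%:R < \sum_j D j + c).

Lemma shortfall_le D N c c' : c <= c' -> shortfall D N c -> shortfall D N c'.
Proof. by move=> cc' /andP[h1 h2]; apply/andP; split; lra. Qed.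

Hypothesis p01 : 0 < p < 1.

Let p_gt0 : 0 < p. Proof. by case/andP: p01. Qed.

Lemma weight_in01 D (j : 'I_n) : (forall j, 0 <= D j <= 1 / p) -> 0 <= p * D j <= 1.
Proof.
move=> /(_ j)/andP[D0 D1]; rewrite mulr_ge0 ?(ltW p_gt0)//=.
by rewrite -(ler_pM2l p_gt0) mulrA mulr1 divff ?gt_eqF// in D1.
Qed.

Lemma shortfall_compl D N c : shortfall D N c ->
  n%:R - c < \sum_(j | j \notin N) D j.
Proof.
move=> /andP[_]; rewrite [X in _ < X + _](bigID (fun j => j \in N)) /=; lra.
Qed.

(* Chernoff bound with the weights [lam `^ (- p D_j)]. *)
Lemma prob_shortfall D A (lam : R) : 1 <= lam -> (forall j, 0 <= D j <= 1 / p) ->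
  \sum_s (shortfall D (hit s (half_edges A)) #|A|%:R)%:R
  <= #|{perm 'I_n * 'I_d}|%:R *
     (lam ^+ #|A| *
      (1 - p * (1 - lam^-1) * (1 - #|A|%:R / n%:R)) ^+ (#|A| * d)).
Proof.
move=> lam1 D01; have lam0 : 0 < lam by apply: lt_le_trans lam1.
have [n0|n0] := posnP n.
  have A0 : #|A| = 0%N by apply/eqP; rewrite -leqn0 -[leqRHS]n0 card_ord_set.
  rewrite big1 => [|s _]; first by rewrite A0 mul0n !expr0 !mulr1.
  by rewrite /shortfall A0 ltNge sumr_ge0// => j _; case/andP: (D01 j).
have n0' : 0 < n%:R :> R by rewrite ltr0n.
have /andP[An0 An] := card_ratio_itv R A.
have lamV0 : 0 < lam^-1 by rewrite invr_gt0.
have lamV : lam^-1 <= 1 by rewrite invf_le1.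
pose w j := expR (p * D j * - ln lam).
pose F N := shortfall D N #|A|%:R.
(* The chord bound gives [1 - w j >= p (1 - 1/lam) D_j], and the missed demand exceeds [n - #|A|];
   together they dictate [k]. *)
pose k := p * (1 - lam^-1) * (1 - #|A|%:R / n%:R).
have lnlam : 0 <= ln lam by rewrite ln_ge0.
have wle j : w j <= 1 - p * D j * (1 - lam^-1).
  have := expR_le_chord (- ln lam) (weight_in01 j D01).
  by rewrite expRN lnK ?posrE// /w; lra.
have w01 j : 0 <= w j <= 1.
  rewrite expR_ge0 -expR0 ler_expR mulrN oppr_le0 mulr_ge0//.
  by case/andP: (weight_in01 j D01).
have k01 : 0 <= k <= 1.
  rewrite /k !mulr_ge0 ?subr_ge0 ?(ltW p_gt0)//=.
  rewrite !mulr_ile1 ?mulr_ge0 ?subr_ge0 ?(ltW p_gt0)//; try lra.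
  by case/andP: p01 => _ /ltW.
have Fdown N N' : N \subset N' -> F N' -> F N.
  move=> NN'; have le : \sum_(j in N) D j <= \sum_(j in N') D j.
    rewrite [leRHS](big_setID N) /= (finset.setIidPr NN') lerDl.
    by apply: sumr_ge0 => j _; case/andP: (D01 j).
  by move=> /andP[h1 h2]; apply/andP; split; lra.
have Fmass N : F N -> n%:R * k <= \sum_(j | j \notin N) (1 - w j).
  move=> /shortfall_compl FN.
  apply: (@le_trans _ _ (\sum_(j | j \notin N) p * (1 - lam^-1) * D j)); last first.
    by apply: ler_sum => j _; have := wle j; lra.
  rewrite -mulr_sumr /k mulrCA ler_wpM2l//.
    by rewrite mulr_ge0 ?(ltW p_gt0)// subr_ge0.
  by rewrite mulrBr mulr1 mulrCA divff ?gt_eqF// mulr1 ltW.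
have := sum_hit_weight w01 k01 Fdown Fmass (half_edges A).
rewrite card_half_edges => bound.
(* Markov's inequality: on the event the hit demand is below [#|A|] and [p <= 1], so the product of
   weights is at least [lam ^- #|A|]. *)
have lamA : 0 < lam ^- #|A| by rewrite invr_gt0 exprn_gt0.
rewrite -(ler_pM2l lamA) mulr_sumr [leRHS]mulrCA.
rewrite mulKf ?gt_eqF ?exprn_gt0//.
apply: le_trans bound; apply: ler_sum => s _; rewrite /hit_weight -/(F _).
case: ifP => [Fs|]; rewrite ?mulr0// mulr1.
rewrite /w -(big_morph _ (@expRD R) (@expR0 R)) -mulr_suml -mulr_sumr.
rewrite -[lam in leLHS]lnK ?posrE// -exprVn -expRN -expRM_natl ler_expR.
rewrite !mulrN lerN2 ler_wpM2r//.
case/andP: (Fs) => Fs1 _.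
apply: (@le_trans _ _ (1 * \sum_(j in hit s (half_edges A)) D j)); last lra.
apply: ler_wpM2r; first by apply: sumr_ge0 => j _; case/andP: (D01 j).
by case/andP: p01 => _ /ltW.
Qed.

(** Having no edge between two vertex sets is symmetric; the inverse pairing reads it from the
    demand side. *)
Lemma hit_half_edgesV s A B :
  [disjoint hit s (half_edges A) & B]%B
  = [disjoint hit (s^-1)%g (half_edges B) & A]%B.
Proof.
have sym (t : {perm 'I_n * 'I_d}) (X Y : {set 'I_n}) : [disjoint hit t (half_edges X) & Y]%B ->
    [disjoint hit (t^-1)%g (half_edges Y) & X]%B.
  move=> dis; apply/pred0P => i /=; apply/negbTE; apply/negP => /andP[].
  move=> /imsetP[[j b]]; rewrite inE /= => /andP[jY _] it iX.
  have := disjointFl dis jY; move=> /negP; apply; apply/imsetP.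
  by exists ((t^-1)%g (j, b)); rewrite ?permKV// !inE -it iX.
by apply/idP/idP => /sym//; rewrite invgK.
Qed.

(** The half-edges of [B] are revealed through the inverse pairing. With weight [0] on [A] and [1]
    elsewhere, [hit_weight] is the indicator of avoiding [A]. *)
Lemma prob_disjoint A B :
  \sum_s [disjoint hit s (half_edges A) & B]%B%:R
  <= #|{perm 'I_n * 'I_d}|%:R * (1 - #|A|%:R / n%:R) ^+ (#|B| * d) :> R.
Proof.
rewrite (reindex_inj invg_inj) /=.
under eq_bigr do rewrite hit_half_edgesV invgK.
have An := card_ratio_itv R A.
pose w (j : 'I_n) : R := (j \notin A)%:R.
pose F (N : {set 'I_n}) := [disjoint N & A]%B.
have w01 j : 0 <= w j <= 1 by rewrite ler0n lern1; case: (_ \notin _).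
have Fdown N N' : N \subset N' -> F N' -> F N by exact: disjointWl.
have Fmass N : F N -> n%:R * (#|A|%:R / n%:R) <= \sum_(j | j \notin N) (1 - w j).
  move=> FN; apply: (@le_trans _ _ #|A|%:R).
    have [->|n0] := eqVneq (n%:R : R) 0; first by rewrite mul0r.
    by rewrite mulrCA divff ?mulr1.
  rewrite -sum1_card natr_sum big_mkcond [leRHS]big_mkcond /=.
  apply: ler_sum => j _; rewrite /w.
  have [jA|jA] := boolP (j \in A); last by rewrite subrr; case: ifP.
  by rewrite (disjointFl FN jA) subr0.
have := sum_hit_weight w01 An Fdown Fmass (half_edges B).
rewrite card_half_edges; apply: le_trans; apply: ler_sum => s _.
rewrite /hit_weight -/(F _); case: ifP => // Fs.
rewrite big1// => j jh; by rewrite /w (disjointFr Fs jh).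
Qed.

(* The nodes missed by [A] carry more than [n - #|A|] units of demand, hence
   are at least [p (n - #|A|)] in number. *)
Lemma prob_shortfall_union D A : (forall j, 0 <= D j <= 1 / p) ->
  \sum_s (shortfall D (hit s (half_edges A)) #|A|%:R)%:R
  <= #|{perm 'I_n * 'I_d}|%:R *
     \sum_(B : {set 'I_n} | (0 < #|B|)%N && (p * (n%:R - #|A|%:R) <= #|B|%:R))
        (1 - #|A|%:R / n%:R) ^+ (#|B| * d) :> R.
Proof.
move=> D01.
rewrite mulr_sumr.
apply: (@le_trans _ _ (\sum_(B : {set 'I_n} | (0 < #|B|)%N && (p * (n%:R - #|A|%:R) <= #|B|%:R))
   \sum_s ([disjoint hit s (half_edges A) & B]%B%:R : R))); last first.
  by apply: ler_sum => B _; exact: prob_disjoint.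
rewrite exchange_big /=; apply: ler_sum => s _.
set N := hit s _; case: (boolP (shortfall _ _ _)) => [sh|_]; last first.
  by rewrite sumr_ge0.
have An : #|A|%:R <= n%:R :> R by rewrite ler_nat card_ord_set.
have := shortfall_compl sh; rewrite -/N => lt.
have eqN : \sum_(j | j \notin N) D j = \sum_(j in ~: N) D j.
  by apply: eq_bigl => j; rewrite inE.
rewrite eqN in lt.
have le : \sum_(j in ~: N) D j <= #|~: N|%:R / p.
  apply: (@le_trans _ _ (\sum_(j in ~: N) 1 / p)).
    by apply: ler_sum => j _; case/andP: (D01 j).
  by rewrite sumr_const mul1r mulr_natl.
rewrite (bigD1 (~: N)) /=; last first.
  (* Strictness of [lt] makes the missed set nonempty even when [A] is everything; an empty [B]
     would only give the trivial bound [1]. *)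
  apply/andP; split.
    have N0 : 0 < #|~: N|%:R / p by apply: le_lt_trans (lt_le_trans lt le); lra.
    by move: N0; rewrite pmulr_lgt0 ?invr_gt0// ltr0n.
  rewrite mulrC -ler_pdivlMr//. lra.
have -> : [disjoint N & ~: N]%B by rewrite -finset.setI_eq0 finset.setICr.
by rewrite lerDl sumr_ge0.
Qed.

End Shortfall.

(** * Union bound *)

Lemma sum_set_card (R : pzSemiRingType) n (g : nat -> R) :
  \sum_(A : {set 'I_n}) g #|A| = \sum_(a < n.+1) 'C(n, a)%:R * g a.
Proof.
rewrite (partition_big (fun A : {set 'I_n} => inord #|A| : 'I_n.+1) predT)//=.
apply: eq_bigr => a _.
rewrite (eq_bigl [pred A : {set 'I_n} | #|A| == a]) => [|A] /=; last first.
  by rewrite -val_eqE /= inordK// ltnS card_ord_set.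
rewrite (eq_bigr (fun=> g a)) => [|A /eqP ->//].
rewrite sumr_const mulr_natl; congr (_ *+ _).
have := card_draws 'I_n a; rewrite card_ord => <-.
by apply: eq_card => A; rewrite !inE.
Qed.

(** With [x = a/n], the term of degree [a] in [(1 + x)^n] is at most [exp (n x) = exp a]. *)
Lemma bin_le_pow (R : realType) (n a : nat) : (0 < a)%N ->
  'C(n, a)%:R <= (expR 1 * n%:R / a%:R) ^+ a :> R.
Proof.
move=> a0; have [na|an] := ltnP n a.
  by rewrite bin_small// exprn_ge0// !mulr_ge0 ?expR_ge0 ?invr_ge0.
have n0 : 0 < n%:R :> R by rewrite ltr0n (leq_trans a0).
have a0' : 0 < a%:R :> R by rewrite ltr0n.
set x : R := a%:R / n%:R.
have x0 : 0 < x by rewrite divr_gt0.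
have -> : expR 1 * n%:R / a%:R = expR 1 / x by rewrite /x invf_div mulrA.
rewrite expr_div_n ler_pdivlMr ?exprn_gt0// -expRM_natl mulr1.
have -> : a%:R = n%:R * x by rewrite /x mulrCA divff ?gt_eqF// mulr1.
rewrite expRM_natl; apply: (@le_trans _ _ ((x + 1) ^+ n)); last first.
  rewrite lerXn2r ?nnegrE ?expR_ge0//; first by rewrite addr_ge0// ltW.
  by rewrite addrC expR_ge1Dx.
rewrite exprD1n (bigD1 (inord a : 'I_n.+1))//= inordK ?ltnS//.
rewrite mulr_natl lerDl sumr_ge0// => i _.
by rewrite mulrn_wge0// exprn_ge0// ltW.
Qed.

Lemma pow6_expR (R : realType) (b : nat) : b%:R ^+ 6 * expR (- b%:R) <= 6`!%:R :> R.
Proof.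
rewrite expRN ler_pdivrMr ?expR_gt0//.
have := @expR_ge1Dxn R b%:R 5 (ler0n _ _).
have F0 : 0 < 6`!%:R :> R by rewrite ltr0n fact_gt0.
move=> h; rewrite -ler_pdivrMl// mulrC; apply: le_trans h.
by rewrite lerDr.
Qed.

(* Here [u = n - #|A|], and [b] is the number of demand nodes missed by [A]. *)
Lemma bin_bin_pow_le (R : realType) (n u b m r d : nat) :
  (0 < u)%N -> (u.*2 <= n)%N -> (0 < b)%N -> (u <= m * b)%N ->
  (m + 7 + r <= d)%N -> expR m.+2%:R * m%:R <= 2 ^+ r :> R ->
  'C(n, u)%:R * ('C(n, b)%:R * (u%:R / n%:R) ^+ (b * d))
    <= 6`!%:R * m%:R ^+ 6 / n%:R ^+ 6 :> R.
Proof.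
move=> u0 un b0 umb dge hr.
have n0 : (0 < n)%N by rewrite (leq_trans u0)// (leq_trans _ un)// -addnn leq_addr.
have nR : 0 < n%:R :> R by rewrite ltr0n.
have uR : 0 < u%:R :> R by rewrite ltr0n.
have bR : 0 < b%:R :> R by rewrite ltr0n.
have eR : 1 <= expR 1 :> R by rewrite -expR0 ler_expR.
have eR0 : 0 < expR 1 :> R by rewrite expR_gt0.
set y : R := u%:R / n%:R.
have y0 : 0 < y by rewrite divr_gt0.
have y2 : y <= 1 / 2.
  rewrite /y ler_pdivrMr// mul1r [leRHS]mulrC ler_pdivlMr//.
  by rewrite -natrM ler_nat muln2.
have y1 : y <= 1 by lra.
have nu : n%:R / u%:R = y^-1 by rewrite /y invf_div.
(* The inequality [u <= m b] brings both binomials to the exponent [b], in terms of [y] alone. *)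
have Cu : 'C(n, u)%:R <= ((expR 1 / y) ^+ m) ^+ b.
  apply: le_trans (bin_le_pow R n u0) _; rewrite -mulrA nu -exprM.
  apply: ler_weXn2l => //.
  by rewrite ler_pdivlMr// mul1r; lra.
have Cb : 'C(n, b)%:R <= (expR 1 * m%:R / y) ^+ b.
  apply: le_trans (bin_le_pow R n b0) _; apply: lerXn2r.
  - by rewrite nnegrE !mulr_ge0 ?invr_ge0 ?exprn_ge0 ?expR_ge0 ?(ltW y0).
  - by rewrite nnegrE !mulr_ge0 ?invr_ge0 ?exprn_ge0 ?expR_ge0 ?(ltW y0).
  rewrite -!mulrA ler_pM2l// -nu ler_pdivrMr//.
  have -> : m%:R * (n%:R / u%:R) * b%:R = n%:R * (m * b)%:R / u%:R :> R.
    by rewrite natrM; ring.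
  by rewrite ler_pdivlMr// ler_pM2l// ler_nat.
(* Of the [m + 7 + r] factors [y], [m] cancel the bound [Cu], one cancels [Cb], six give the decay
   [n^-6], and the last [r], as [y <= 1/2], absorb the constants through [hr]. *)
have yd : y ^+ d <= y ^+ m * y * y ^+ 6 * y ^+ r.
  rewrite -exprSr -!exprD; apply: ler_wiXn2l; rewrite ?(ltW y0)//.
  by apply: leq_trans dge; rewrite leq_add2r addSn -addnS.
have yr : y ^+ r <= 1 / 2 ^+ r.
  have -> : 1 / 2 ^+ r = (1 / 2 : R) ^+ r by rewrite !mul1r exprVn.
  by rewrite lerXn2r ?nnegrE ?(ltW y0).
have base : (expR 1 / y) ^+ m * (expR 1 * m%:R / y) * y ^+ d
    <= y ^+ 6 * expR (- 1).
  apply: (@le_trans _ _ ((expR 1 / y) ^+ m * (expR 1 * m%:R / y) *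
      (y ^+ m * y * y ^+ 6 * (1 / 2 ^+ r)))).
    rewrite ler_wpM2l//.
      by rewrite !mulr_ge0 ?exprn_ge0 ?mulr_ge0 ?invr_ge0 ?expR_ge0 ?(ltW y0).
    apply: le_trans yd _; rewrite ler_wpM2l//.
    by rewrite !mulr_ge0 ?exprn_ge0 ?(ltW y0).
  have -> : (expR 1 / y) ^+ m * (expR 1 * m%:R / y) *
      (y ^+ m * y * y ^+ 6 * (1 / 2 ^+ r))
      = y ^+ 6 * (expR 1 ^+ m * expR 1 * m%:R / 2 ^+ r).
    rewrite expr_div_n; field.
    by rewrite !expf_neq0 ?gt_eqF.
  rewrite ler_wpM2l ?exprn_ge0 ?(ltW y0)// ler_pdivrMr ?exprn_gt0//.
  rewrite -(ler_pM2l eR0) [leRHS]mulrA -expRD subrr expR0 mul1r.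
  apply: le_trans hr; rewrite -[m.+2%:R]mulr1 expRM_natl !exprS; lra.
apply: (@le_trans _ _ ((y ^+ 6 * expR (- 1)) ^+ b)).
  rewrite mulrA mulnC exprM.
  apply: (@le_trans _ _ (((expR 1 / y) ^+ m) ^+ b * (expR 1 * m%:R / y) ^+ b * (y ^+ d) ^+ b)).
    rewrite ler_wpM2r ?exprn_ge0 ?(ltW y0)//.
    by rewrite ler_pM.
  rewrite -!exprMn lerXn2r// nnegrE.
    by rewrite !mulr_ge0 ?exprn_ge0 ?mulr_ge0 ?invr_ge0 ?(ltW y0) ?(ltW eR0).
  by rewrite mulr_ge0 ?expR_ge0 ?exprn_ge0 ?(ltW y0).
rewrite exprMn -expRM_natl mulrN mulr1.
have y61 : (y ^+ 6) ^+ b <= y ^+ 6.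
  rewrite -[leRHS]expr1; apply: ler_wiXn2l => //; first by rewrite exprn_ge0// ltW.
  by rewrite exprn_ile1// ltW.
apply: (@le_trans _ _ (y ^+ 6 * expR (- b%:R))).
  by rewrite ler_wpM2r ?expR_ge0.
rewrite /y expr_div_n mulrAC ler_wpM2r ?invr_ge0 ?exprn_ge0//.
(* Trading [u] for [m b] lets [exp (- b)] absorb [b^6], so the bound is uniform in [b]. *)
apply: (@le_trans _ _ ((m * b)%:R ^+ 6 * expR (- b%:R))).
  by rewrite ler_wpM2r ?expR_ge0// lerXn2r ?nnegrE// ler_nat.
rewrite natrM exprMn mulrC mulrCA [leRHS]mulrC ler_wpM2l ?exprn_ge0//.
by rewrite mulrC pow6_expR.
Qed.

(** * Supply sets of small, medium and large size *)

Section UnionBound.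
Variables (R : realType) (n d : nat) (p t lam : R) (m r : nat) (D : 'I_n -> R).
Hypotheses (p01 : 0 < p < 1) (t0 : 0 < t) (lam2 : 2 <= lam).
Hypothesis D01 : forall j, 0 <= D j <= 1 / p.
Hypotheses (pm : 1 / p <= m%:R) (dge : (m + 7 + r <= d)%N).
Hypothesis hr : expR m.+2%:R * m%:R <= 2 ^+ r :> R.
Hypothesis nge : (2 * 6`! * m ^ 6 <= n)%N.
Hypothesis small_sets : forall a : nat, t < a%:R -> a%:R * lam <= n%:R ->
  (expR 1 * n%:R / a%:R * lam * (1 - p * (1 - 2 / lam)) ^+ d) ^+ a <= n%:R ^- 3.
Hypothesis medium_base : expR 2 * lam ^+ 2 <= expR (p * d%:R / 4).
Hypothesis medium_size : expR (- (n%:R / lam)) <= n%:R ^- 3.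

Let p_gt0 : 0 < p. Proof. by case/andP: p01. Qed.
Let m_gt0 : (0 < m)%N.
Proof. by rewrite -(@ltr_nat R); apply: lt_le_trans pm; rewrite divr_gt0. Qed.
Let n_gt0 : (0 < n)%N.
Proof. by apply: leq_trans nge; rewrite !muln_gt0 m_gt0. Qed.
Let d_gt0 : (0 < d)%N.
Proof. by apply: leq_trans dge; rewrite addnAC addn_gt0 orbT. Qed.
Let nR : 0 < n%:R :> R. Proof. by rewrite ltr0n. Qed.
Let lam0 : 0 < lam. Proof. by apply: lt_le_trans lam2. Qed.

Let prob_sets (A : {set 'I_n}) : R :=
  \sum_s (shortfall D (hit s (half_edges d A)) #|A|%:R)%:R.

(** Gathers binomial and Chernoff bound into one power. [base'] is left free because small and
    medium sets simplify the base differently. *)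
Lemma bin_prob_le (A : {set 'I_n}) (base base' : R) :
  (0 < #|A|)%N -> 0 <= 1 - base -> 1 - base <= base' ->
  base = p * (1 - lam^-1) * (1 - #|A|%:R / n%:R) ->
  'C(n, #|A|)%:R * prob_sets A <= #|{perm 'I_n * 'I_d}|%:R *
    (expR 1 * n%:R / #|A|%:R * lam * base' ^+ d) ^+ #|A|.
Proof.
move=> A0 base0 basele baseE.
have lam1 : 1 <= lam by apply: le_trans lam2; rewrite ler1n.
have := prob_shortfall d p01 A lam1 D01; rewrite -baseE => h.
apply: (@le_trans _ _ ((expR 1 * n%:R / #|A|%:R) ^+ #|A| *
   (#|{perm 'I_n * 'I_d}|%:R * (lam ^+ #|A| * (1 - base) ^+ (#|A| * d))))).
  by rewrite ler_pM ?sumr_ge0// bin_le_pow.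
rewrite mulrCA ler_wpM2l// mulrA mulnC exprM -!exprMn.
have c0 : 0 <= expR 1 * n%:R / #|A|%:R * lam.
  by rewrite !mulr_ge0 ?expR_ge0 ?invr_ge0// ltW.
have base'0 : 0 <= base' by apply: le_trans basele.
apply: lerXn2r; rewrite ?nnegrE ?(mulr_ge0 c0) ?exprn_ge0//.
by rewrite ler_wpM2l// lerXn2r// nnegrE.
Qed.

(** Union over the missed sets [B], grouped by size [b]; [1 / p <= m] gives [u <= m b]. The [n + 1]
    sizes and the constant [6! m^6] cost at most [n^2], leaving [n^-4 <= n^-3]. *)
Lemma bin_prob_large (A : {set 'I_n}) : (n < #|A|.*2)%N ->
  'C(n, #|A|)%:R * prob_sets A <= #|{perm 'I_n * 'I_d}|%:R * n%:R ^- 3.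
Proof.
move=> nA; have An := card_ord_set A.
set u := (n - #|A|)%N.
have un : (u.*2 <= n)%N by rewrite /u doubleB leq_subLR -addnn leq_add2r ltnW.
have uE : n%:R - #|A|%:R = u%:R :> R by rewrite natrB.
have baseE : 1 - #|A|%:R / n%:R = u%:R / n%:R :> R.
  by rewrite -uE mulrBl divff// gt_eqF.
have := prob_shortfall_union d p01 A D01; rewrite uE baseE -/(prob_sets A) => h.
have -> : 'C(n, #|A|) = 'C(n, u) by rewrite /u bin_sub.
apply: le_trans (ler_wpM2l (ler0n _ _) h) _.
rewrite mulrCA ler_wpM2l//.
pose g b : R := if (0 < b)%N && (p * u%:R <= b%:R) then (u%:R / n%:R) ^+ (b * d) else 0.
rewrite (_ : \sum_(B : {set 'I_n} | _) _ = \sum_(B : {set 'I_n}) g #|B|); last first.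
  by rewrite big_mkcond.
rewrite sum_set_card mulr_sumr.
apply: (@le_trans _ _ (\sum_(b < n.+1) 6`!%:R * m%:R ^+ 6 / n%:R ^+ 6)).
  apply: ler_sum => b _; rewrite /g; case: ifP => [/andP[b0 ub]|_]; last first.
    by rewrite !mulr0 !mulr_ge0 ?invr_ge0 ?exprn_ge0.
  (* If [A] contains every supply node, the term is a positive power of [0]. *)
  have [u0|u0] := posnP u.
    rewrite u0 mul0r expr0n muln_eq0 !gtn_eqF//=.
    by rewrite !mulr0 !mulr_ge0 ?invr_ge0 ?exprn_ge0.
  apply: bin_bin_pow_le dge hr => //.
  rewrite -(@ler_nat R) natrM.
  apply: (@le_trans _ _ (b%:R / p)); first by rewrite ler_pdivlMr// mulrC.
  by rewrite [leRHS]mulrC ler_wpM2l//; move: pm; rewrite mul1r.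
rewrite sumr_const card_ord -[_ *+ n.+1]mulr_natl.
have n2 : n.+1%:R <= 2 * n%:R :> R.
  by rewrite -natrM ler_nat; move: n_gt0; clear; case: n => // k _; rewrite mulSn mul1n addSn ltnS leq_addl.
apply: (@le_trans _ _ (n%:R * (n%:R / n%:R ^+ 6))).
  apply: (@le_trans _ _ (2 * n%:R * (6`!%:R * m%:R ^+ 6 / n%:R ^+ 6))).
    by rewrite ler_wpM2r// !mulr_ge0 ?invr_ge0 ?exprn_ge0.
  have le : 2 * 6`!%:R * m%:R ^+ 6 <= n%:R :> R by rewrite -natrX -!natrM ler_nat.
  rewrite -mulrA mulrCA ler_wpM2l// mulrA ler_wpM2r ?invr_ge0 ?exprn_ge0//.
  lra.
have -> : n%:R * (n%:R / n%:R ^+ 6) = n%:R ^- 3 / n%:R :> R.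
  by field; rewrite gt_eqF.
by rewrite ler_pdivrMr// ler_peMr ?invr_ge0 ?exprn_ge0// ler1n.
Qed.

(** Above [n / 2] the missed sets are used, up to [n / lam] the hypothesis [small_sets]. In between,
    [n / #|A| < lam] and [medium_base] bring the base below [exp (- 1)], and [medium_size]
    concludes. *)
Lemma bin_prob (A : {set 'I_n}) : t < #|A|%:R ->
  'C(n, #|A|)%:R * prob_sets A <= #|{perm 'I_n * 'I_d}|%:R * n%:R ^- 3.
Proof.
move=> tA; have A0' : 0 < #|A|%:R :> R by apply: lt_trans tA.
have A0 : (0 < #|A|)%N by rewrite -(ltr0n R).
have [|An] := ltnP n #|A|.*2; first exact: bin_prob_large.
have p1 : p < 1 by case/andP: p01.
have /andP[x0 _] := card_ratio_itv R A; set x := (_ / _) in x0.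
have x2 : x <= 1 / 2.
  rewrite /x ler_pdivrMr// mul1r [leRHS]mulrC ler_pdivlMr//.
  by rewrite -natrM ler_nat muln2.
have l0 : 0 < lam^-1 by rewrite invr_gt0.
have l2 : lam^-1 <= 1 / 2 by rewrite div1r lef_pV2 ?posrE.
set base := p * (1 - lam^-1) * (1 - x).
have base0 : 0 <= 1 - base.
  have /andP[c0 c1] : 0 <= 1 - lam^-1 <= 1 by apply/andP; split; lra.
  have /andP[e0 e1] : 0 <= 1 - x <= 1 by apply/andP; split; lra.
  rewrite subr_ge0 /base mulr_ile1 ?mulr_ge0 ?(ltW p_gt0)//.
  by rewrite mulr_ile1 ?(ltW p_gt0) ?(ltW p1).
have [le|lt] := lerP (#|A|%:R * lam) n%:R.
  apply: (@le_trans _ _ (#|{perm 'I_n * 'I_d}|%:R *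
      (expR 1 * n%:R / #|A|%:R * lam * (1 - p * (1 - 2 / lam)) ^+ d) ^+ #|A|)).
    apply: (bin_prob_le A0 base0) => //.
    (* For small sets this gives [(1 - 1/lam) (1 - x) >= 1 - 2/lam]. *)
    have xl : x <= lam^-1 by rewrite /x ler_pdivrMr// mulrC ler_pdivlMr.
    rewrite lerB// /base -mulrA ler_wpM2l ?(ltW p_gt0)//.
    have : 0 <= lam^-1 * x by rewrite mulr_ge0// ltW.
    lra.
  by rewrite ler_wpM2l// small_sets.
apply: (@le_trans _ _ (#|{perm 'I_n * 'I_d}|%:R *
    (expR 1 * n%:R / #|A|%:R * lam * expR (- (p / 4)) ^+ d) ^+ #|A|)).
  apply: (bin_prob_le A0 base0) => //.
  (* Both [1 - 1/lam] and [1 - x] are at least [1/2], whence the rate [p / 4]. *)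
  apply: (@le_trans _ _ (1 - p / 4)); last exact: expR_ge1Dx.
  rewrite lerB// /base -mulrA ler_wpM2l ?(ltW p_gt0)//.
  have : (1 / 2) * (1 / 2) <= (1 - lam^-1) * (1 - x) by apply: ler_pM; lra.
  lra.
rewrite ler_wpM2l//; apply: le_trans medium_size.
apply: (@le_trans _ _ (expR (- 1) ^+ #|A|)); last first.
  rewrite -expRM_natl mulrN mulr1 ler_expR lerN2 ler_pdivrMr//.
  exact: ltW.
rewrite lerXn2r ?nnegrE ?expR_ge0//.
  by rewrite !mulr_ge0 ?expR_ge0 ?invr_ge0 ?exprn_ge0// ltW.
rewrite -expRM_natl.
have -> : d%:R * - (p / 4) = - (p * d%:R / 4) by ring.
rewrite expRN ler_pdivrMr ?expR_gt0// -(ler_pM2l (expR_gt0 1)).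
rewrite [leRHS]mulrA -(expRD 1) subrr expR0 mul1r.
apply: le_trans medium_base.
have -> : expR 2 = expR 1 * expR 1 :> R by rewrite -expRD.
rewrite -!mulrA ler_wpM2l ?expR_ge0// ler_wpM2l ?expR_ge0//.
rewrite expr2 mulrA ler_wpM2r ?(ltW lam0)// ler_pdivrMr// mulrC.
exact: ltW.
Qed.

Lemma prob_deficient :
  \sum_(s : {perm 'I_n * 'I_d})
    [exists A : {set 'I_n}, shortfall D (hit s (half_edges d A)) (#|A|%:R - t)]%:R
  <= #|{perm 'I_n * 'I_d}|%:R * n%:R ^- 2 :> R.
Proof.
(* The sets of each positive size share a failure probability [n^-3]; the [n] sizes add up to
   [n^-2]. *)
pose g a : R := if (0 < a)%N then n%:R ^- 3 / 'C(n, a)%:R else 0.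
apply: (@le_trans _ _ (\sum_(A : {set 'I_n}) \sum_(s : {perm 'I_n * 'I_d})
    (shortfall D (hit s (half_edges d A)) (#|A|%:R - t))%:R)).
  rewrite exchange_big /=; apply: ler_sum => s _.
  case: existsP => [[A sA]|_]; last by rewrite sumr_ge0.
  by rewrite (bigD1 A)//= sA lerDl sumr_ge0.
apply: (@le_trans _ _ (\sum_(A : {set 'I_n}) #|{perm 'I_n * 'I_d}|%:R * g #|A|)).
  apply: ler_sum => A _.
  (* If [#|A| <= t], the threshold [#|A| - t] is nonpositive and no shortfall occurs; for larger
     sets the slack [t] is given up. *)
  have [tA|At] := ltP t #|A|%:R; last first.
    rewrite big1 => [|s _].
      by rewrite mulr_ge0// /g; case: ifP; rewrite // mulr_ge0 ?invr_ge0 ?exprn_ge0.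
    rewrite /shortfall (_ : _ < _ = false)//; apply/negbTE; rewrite -leNgt.
    apply: (@le_trans _ _ 0); first by rewrite subr_le0.
    by apply: sumr_ge0 => j _; case/andP: (D01 j).
  have C0 : 0 < 'C(n, #|A|)%:R :> R by rewrite ltr0n bin_gt0 card_ord_set.
  rewrite /g -(ltr0n R) (lt_trans t0 tA) mulrA ler_pdivlMr// mulrC.
  apply: le_trans (bin_prob tA); rewrite ler_wpM2l//.
  apply: ler_sum => s _; rewrite ler_nat.
  by case: (boolP (shortfall _ _ (_ - _))) => // /(shortfall_le _) ->//; rewrite gerDl oppr_le0 ltW.
rewrite -mulr_sumr ler_wpM2l// sum_set_card big_ord_recl {1}/g ltnn mulr0 add0r.
apply: (@le_trans _ _ (\sum_(i < n) n%:R ^- 3)).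
  apply: ler_sum => i _; rewrite /g /= mulrCA divff ?mulr1//.
  by rewrite pnatr_eq0 -lt0n bin_gt0 /bump add1n ltn_ord.
rewrite sumr_const card_ord -[_ *+ n]mulr_natl.
have -> // : n%:R * n%:R ^- 3 = n%:R ^- 2 :> R.
by field; rewrite gt_eqF.
Qed.

End UnionBound.

(** * Expected loss *)

Section Loss.
Variables (R : realType) (n : nat).
Implicit Types (G : bimultigraph n) (D : n.-tuple R) (A : {set 'I_n}) (x : 'M[R]_n).

Definition neighbours G A : {set 'I_n} :=
  [set j | [exists i in A, Defs.adjacent G i j]]%SET.

Lemma neighbours_configuration d (s : {perm 'I_n * 'I_d}) A :
  neighbours (configuration_graph s) A = hit s (half_edges d A).
Proof.
apply/finset.setP => j; rewrite inE; apply/exists_inP/imsetP => [[i iA]|[[i a]]].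
  rewrite /Defs.adjacent mxE => /card_gt0P[a]; rewrite inE => /eqP <-.
  by exists (i, a); rewrite // !inE iA.
rewrite !inE /= andbT => iA ->; exists i => //.
by rewrite /Defs.adjacent mxE; apply/card_gt0P; exists a; rewrite inE.
Qed.

Lemma flow_value_ge0 G D x : feasible_flow G D x -> 0 <= flow_value G x.
Proof. by case=> x0 _ _; apply: sumr_ge0 => i _; exact: sumr_ge0. Qed.

Lemma flow_value_le_supply G D x : feasible_flow G D x -> flow_value G x <= n%:R.
Proof.
case=> _ x1 _; apply: (@le_trans _ _ (\sum_(i < n) 1)); first exact: ler_sum.
by rewrite sumr_const card_ord.
Qed.

Lemma flow_value_le_demand G D x :
  feasible_flow G D x -> flow_value G x <= \sum_j tnth D j.
Proof.
case=> _ _ xD; rewrite /flow_value (exchange_big_dep predT)//=.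
exact: ler_sum.
Qed.

Lemma has_ubound_flow G D :
  has_ubound [set flow_value G x | x in feasible_flow G D].
Proof. by exists n%:R => _ [x /flow_value_le_supply xn <-]. Qed.

(** The condition [0 <= v] covers an infeasible program, whose value is [sup set0 = 0]. *)
Lemma max_flow_le G D v : 0 <= v ->
  (forall x, feasible_flow G D x -> flow_value G x <= v) -> max_flow G D <= v.
Proof.
move=> v0 h; rewrite /max_flow.
have [->|E] := eqVneq [set flow_value G x | x in feasible_flow G D] set0.
  by rewrite sup0.
by apply: ge_sup; [exact/set0P|move=> _ [x /h xv <-]].
Qed.

Lemma le_max_flow G D x : feasible_flow G D x -> flow_value G x <= max_flow G D.
Proof. by move=> fx; apply: ub_le_sup; [exact: has_ubound_flow|exists x]. Qed.

Lemma max_flow_ge0 G D : 0 <= max_flow G D.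
Proof.
rewrite /max_flow.
have [->|/set0P[_ [x fx _]]] :=
    eqVneq [set flow_value G x | x in feasible_flow G D] set0.
  by rewrite sup0.
exact: le_trans (flow_value_ge0 fx) (le_max_flow fx).
Qed.

Lemma max_flow_le_complete G D : max_flow G D <= max_flow (complete_bigraph n) D.
Proof.
apply: max_flow_le => [|x [x0 x1 xD]]; first exact: max_flow_ge0.
have complete i j : Defs.adjacent (complete_bigraph n) i j by rewrite /Defs.adjacent mxE.
(* Feasibility in [G] puts no upper bound on the entries of [x] off its edges, so these are
   erased. *)
pose y : 'M[R]_n := \matrix_(i, j) if Defs.adjacent G i j then x i j else 0.
have y1 i : \sum_(j | Defs.adjacent (complete_bigraph n) i j) y i j
    = \sum_(j | Defs.adjacent G i j) x i j.
  rewrite [RHS]big_mkcond /= (eq_bigl predT) => [|j]; last by rewrite complete.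
  by apply: eq_bigr => j _; rewrite mxE.
have yD j : \sum_(i | Defs.adjacent (complete_bigraph n) i j) y i j
    = \sum_(i | Defs.adjacent G i j) x i j.
  rewrite [RHS]big_mkcond /= (eq_bigl predT) => [|i]; last by rewrite complete.
  by apply: eq_bigr => i _; rewrite mxE.
have -> : flow_value G x = flow_value (complete_bigraph n) y.
  by apply: eq_bigr => i _; rewrite y1.
apply: le_max_flow; split=> [i j|i|j]; last by rewrite yD.
  by rewrite mxE; case: ifP.
by rewrite y1.
Qed.

Lemma loss_ge0 G D : 0 <= loss G D.
Proof. by rewrite subr_ge0 max_flow_le_complete. Qed.

Lemma loss_le_supply G D : loss G D <= n%:R.
Proof.
apply: (@le_trans _ _ (max_flow (complete_bigraph n) D)).
  by rewrite gerBl max_flow_ge0.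
by apply: max_flow_le => // x /flow_value_le_supply.
Qed.

(** For an edgeless [(A, B)] the neighbours of [A] lie outside [B], so the cut is at least
    [n - #|A|] plus their demand. Without shortfall this is at least [v], and the complete graph
    carries at most [v + t]. *)
Lemma loss_le G D t : (forall j, 0 <= tnth D j) ->
  (forall A, ~~ shortfall (tnth D) (neighbours G A) (#|A|%:R - t)) ->
  loss G D <= t.
Proof.
move=> D0 good; pose v := Num.min n%:R (\sum_j tnth D j) - t.
have vn : v <= n%:R - t by rewrite lerD2r ge_min lexx.
have vD : v <= \sum_j tnth D j - t by rewrite lerD2r ge_min lexx orbT.
pose E := [set ij : 'I_n * 'I_n | Defs.adjacent G ij.1 ij.2]%SET.
have cut_ge C : edgeless E C -> v <= cut (fun=> 1) (tnth D) C.
  case: C => A B /edgelessP eAB.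
  have -> : cut (fun=> 1) (tnth D) (A, B)
      = n%:R - #|A|%:R + \sum_(j | j \notin B) tnth D j.
    have nA : n%:R = #|A|%:R + #|[predC A]|%:R :> R by rewrite -natrD cardC card_ord.
    by rewrite /cut /= sumr_const nA [_ + #|_|%:R]addrC addrK addrC.
  have NB : \sum_(j in neighbours G A) tnth D j <= \sum_(j | j \notin B) tnth D j.
    rewrite [leLHS]big_mkcond [leRHS]big_mkcond; apply: ler_sum => j _.
    rewrite inE; case: existsP => [[i /andP[iA ij]]|_]; last by case: ifP.
    by case: (boolP (j \in B)) => // jB; have := eAB _ _ iA jB; rewrite inE ij.
  have := good A; rewrite negb_and -!leNgt => /orP[]; lra.
have [||x [x0 xE xc xD xv]] := max_flow_min_cut _ _ cut_ge => //.
pose y : 'M[R]_n := \matrix_(i, j) x i j.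
have x_out i j : ~~ Defs.adjacent G i j -> x i j = 0 by move=> ij; apply: xE; rewrite inE.
have yr i : \sum_(j | Defs.adjacent G i j) y i j = \sum_j x i j.
  rewrite [RHS](bigID (Defs.adjacent G i)) /= [X in _ + X]big1 => [|j /x_out//].
  by rewrite addr0; apply: eq_bigr => j _; rewrite mxE.
have yc j : \sum_(i | Defs.adjacent G i j) y i j = \sum_i x i j.
  rewrite [RHS](bigID (fun i => Defs.adjacent G i j)) /= [X in _ + X]big1 => [|i /x_out//].
  by rewrite addr0; apply: eq_bigr => i _; rewrite mxE.
have vy : v <= max_flow G D.
  apply: (@le_trans _ _ (flow_value G y)).
    by apply: le_trans xv _; rewrite /flow_value; under [leRHS]eq_bigr do rewrite yr.
  by apply: le_max_flow; split=> [i j|i|j]; rewrite ?mxE ?yr ?yc.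
have : max_flow (complete_bigraph n) D <= Num.min n%:R (\sum_j tnth D j).
  apply: max_flow_le => [|x' fx'].
    by rewrite le_min ler0n sumr_ge0.
  by rewrite le_min (flow_value_le_supply fx') (flow_value_le_demand fx').
by rewrite /loss; move: vy; rewrite /v; lra.
Qed.

End Loss.

(** The integral is a supremum over the simple functions below the integrand. This form applies
    directly to [loss], whose measurability is not established here. *)
Lemma ge0_integral_mono d (T : measurableType d) (R : realType)
    (mu : {measure set T -> \bar R}) (f g : T -> \bar R) :
  (forall x, 0 <= f x)%E -> (forall x, f x <= g x)%E ->
  (\int[mu]_x f x <= \int[mu]_x g x)%E.
Proof.
move=> f0 fg; have g0 x : (0 <= g x)%E by exact: le_trans (f0 x) (fg x).
rewrite !ge0_integralTE//; apply: le_ereal_sup => _ [h /= hf <-].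
by exists h => //= x; exact: le_trans (hf x) (fg x).
Qed.

(** * From fixed demand vectors to the expected loss *)

Section ExpectedLoss.
Variables (R : realType) (n d : nat) (p t : R).
Variable mu : demand_distribution R n.
Hypothesis mu_p : demand_class p mu.
Implicit Types (D : n.-tuple (measurableTypeR R)) (s : {perm 'I_n * 'I_d}).

Definition in_box (j : 'I_n) : set (n.-tuple (measurableTypeR R)) :=
  [set D | 0 <= tnth D j <= 1 / p].

(** A finite union of null sets, outside which all coordinates obey their bounds at once, whatever
    the joint law. *)
Definition out_box : set (n.-tuple (measurableTypeR R)) :=
  \big[setU/set0]_(j < n) ~` in_box j.

Lemma out_boxN D : ~ out_box D -> forall j, 0 <= tnth D j <= 1 / p.
Proof.
rewrite /out_box -bigcup_seq => nD j; apply: contrapT => nj; apply: nD.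
by exists j => //=; exact: mem_index_enum.
Qed.

Lemma measurable_in_box j : measurable (in_box j).
Proof.
rewrite /in_box (_ : [set D | _] = (@tnth _ _ ^~ j) @^-1` `[0, 1 / p]%classic).
  by rewrite -[X in measurable X]setTI; exact: measurable_tnth.
by apply/seteqP; split=> D /=; rewrite in_itv.
Qed.

Lemma out_box_null : measurable out_box /\ mu out_box = 0%E.
Proof.
rewrite /out_box; elim/big_ind : _ => [|A B [mA A0] [mB B0]|j _].
- by rewrite measure0.
- by split; [exact: measurableU|rewrite measureU0].
- split; first by apply: measurableC; exact: measurable_in_box.
  by rewrite probability_setC ?mu_p ?subee//; exact: measurable_in_box.
Qed.

Definition deficient s : set (n.-tuple (measurableTypeR R)) :=
  [set D | [exists A : {set 'I_n},
    shortfall (tnth D) (hit s (half_edges d A)) (#|A|%:R - t)]].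

Lemma measurable_deficient s : measurable (deficient s).
Proof.
have -> : deficient s = \big[setU/set0]_(A : {set 'I_n})
    [set D : n.-tuple (measurableTypeR R) |
      shortfall (tnth D) (hit s (half_edges d A)) (#|A|%:R - t)].
  rewrite -bigcup_seq; apply/seteqP; split=> D /=.
    by case/existsP => A sA; exists A => //=; exact: mem_index_enum.
  by case=> A _ sA; apply/existsP; exists A.
apply: bigsetU_measurable => A _.
rewrite (_ : [set D | _] = setT `&` (fun D : n.-tuple (measurableTypeR R) =>
    shortfall (tnth D) (hit s (half_edges d A)) (#|A|%:R - t)) @^-1` [set true]); last first.
  by rewrite setTI.
have msum (P : pred 'I_n) :
    measurable_fun setT (fun D : n.-tuple (measurableTypeR R) => \sum_(j | P j) tnth D j : R).
  rewrite (_ : (fun _ => _) = fun D => \sum_(j <- [seq j <- index_enum 'I_n | P j]) tnth D j); last first.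
    by apply/funext => D; rewrite big_filter.
  by apply: measurable_sum => j; exact: measurable_tnth.
have mshort : measurable_fun setT (fun D : n.-tuple (measurableTypeR R) =>
    shortfall (tnth D) (hit s (half_edges d A)) (#|A|%:R - t)).
  apply: measurable_and; apply: measurable_fun_ltr.
  - exact: msum.
  - exact: measurable_cst.
  - by apply: measurable_funD; [exact: msum|exact: measurable_cst].
  - by apply: measurable_funD; [exact: msum|exact: measurable_cst].
by apply: mshort.
Qed.

Definition deficient_mass s : R := fine (mu (deficient s `\` out_box)).

Lemma deficient_massE s : (deficient_mass s)%:E = mu (deficient s `\` out_box).
Proof.
rewrite fineK// fin_num_measure//; apply: measurableD.
  exact: measurable_deficient.
by case: out_box_null.
Qed.

(** The loss is at most [n] on [deficient s] and on the null set [out_box], and at most [t]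
    elsewhere by [loss_le]. *)
Lemma expected_loss_le s : 0 <= t ->
  (expected_loss mu (configuration_graph s) <= (t + n%:R * deficient_mass s)%:E)%E.
Proof.
move=> t0; have [mO O0] := out_box_null; have mF := measurable_deficient s.
set W := deficient s `|` out_box.
have mW : measurable W by exact: measurableU.
have WE : mu W = (deficient_mass s)%:E.
  rewrite deficient_massE -(@measureU0 _ _ _ mu (_ `\` _) out_box)//; last exact: measurableD.
  congr (mu _); apply/seteqP; split=> D [|]; rewrite /W; try by right.
    by have [oD|noD] := pselect (out_box D); [right|left].
  by case; left.
rewrite /expected_loss unlock.
apply: (@le_trans _ _ (\int[mu]_D (t%:E + n%:R%:E * (\1_W D)%:E))%E).
  apply: ge0_integral_mono => D; first by rewrite lee_fin loss_ge0.
  rewrite -EFinM -EFinD lee_fin indicE.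
  have [_|DW] := boolP (D \in W).
    by rewrite mulr1; apply: le_trans (loss_le_supply _ _) _; rewrite lerDr.
  rewrite mulr0 addr0; move: DW; rewrite notin_setE => DW.
  apply: loss_le => [j|A].
    by have /(_ j)/andP[] : forall j, 0 <= tnth D j <= 1 / p
      by apply: out_boxN => oD; apply: DW; right.
  rewrite neighbours_configuration; apply/negP => sA; apply: DW; left.
  by apply/existsP; exists A.
have mI : measurable_fun setT (fun D => (\1_W D)%:E : \bar R).
  by apply/measurable_EFinP; exact: measurable_indic.
have I0 D : (0 <= (\1_W D)%:E :> \bar R)%E by rewrite lee_fin.
rewrite ge0_integralD//=; last exact: measurable_funeM.
rewrite integral_cst//= probability_setT mule1 ge0_integralZl//.
suff -> : (\int[mu]_D (\1_W D)%:E = (deficient_mass s)%:E)%E by rewrite -EFinM -EFinD.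
by rewrite integral_indic// setIT; exact: WE.
Qed.

(** Exchanges the sum over pairings with the integral over demands: the inner sum is at most [beta]
    in the box and vanishes on [out_box]. *)
Lemma sum_deficient_mass (beta : R) : 0 <= beta ->
  (forall D : 'I_n -> R, (forall j, 0 <= D j <= 1 / p) ->
    \sum_s [exists A : {set 'I_n},
      shortfall D (hit s (half_edges d A)) (#|A|%:R - t)]%:R <= beta) ->
  \sum_s deficient_mass s <= beta.
Proof.
move=> beta0 hbeta; have [mO O0] := out_box_null.
have mW s : measurable (deficient s `\` out_box).
  by apply: measurableD => //; exact: measurable_deficient.
rewrite -lee_fin -sumEFin.
rewrite (eq_bigr (fun s => \int[mu]_D (\1_(deficient s `\` out_box) D)%:E)%E); last first.
  by move=> s _; rewrite integral_indic// setIT deficient_massE.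
have mI s : measurable_fun setT
    (fun D => (\1_(deficient s `\` out_box) D)%:E : \bar R).
  by apply/measurable_EFinP; exact: measurable_indic.
rewrite -ge0_integral_sum//.
apply: (@le_trans _ _ (\int[mu]_D (cst beta%:E D))%E); last first.
  by rewrite integral_cst//= probability_setT mule1.
apply: ge0_integral_mono => D; first by apply: sume_ge0 => s _; rewrite lee_fin.
rewrite sumEFin lee_fin /=.
have [oD|noD] := pselect (out_box D).
  rewrite big1// => s _; rewrite indicE memNset// => -[_]; exact.
apply: le_trans (hbeta (tnth D) (out_boxN noD)); apply: ler_sum => s _.
rewrite indicE ler_nat; case: (boolP (D \in _)) => // /set_mem[/= sD _].
by rewrite sD.
Qed.

(* Markov's inequality applied to the mass of the deficient demands. *)
Lemma configuration_prob_expected_loss : (0 < n)%N -> 1 <= t ->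
  (forall D : 'I_n -> R, (forall j, 0 <= D j <= 1 / p) ->
    \sum_s [exists A : {set 'I_n},
      shortfall D (hit s (half_edges d A)) (#|A|%:R - t)]%:R
    <= #|{perm 'I_n * 'I_d}|%:R * n%:R ^- 2 :> R) ->
  1 - 1 / n%:R <= configuration_prob R d
    (fun G => (expected_loss mu G <= (2 * t)%:E)%E).
Proof.
move=> n0 t1 hD; have n0' : 0 < n%:R :> R by rewrite ltr0n.
have t0 : 0 <= t by apply: le_trans t1.
have beta0 : 0 <= #|{perm 'I_n * 'I_d}|%:R * n%:R ^- 2 :> R.
  by rewrite mulr_ge0 ?invr_ge0 ?exprn_ge0.
have mass := sum_deficient_mass beta0 hD.
set good := fun G => _; rewrite /configuration_prob.
set S := [set s | _]%SET.
have perm0 : 0 < #|{perm 'I_n * 'I_d}|%:R :> R.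
  by rewrite ltr0n; apply/card_gt0P; exists 1%g.
rewrite finset.cardsT ler_pdivlMr//.
(* A pairing outside [S] has [n * deficient_mass s >= 1], since otherwise its expected loss is at
   most [t + 1 <= 2 t]. *)
have bad : #|~: S|%:R <= n%:R * \sum_s deficient_mass s.
  rewrite -sum1_card natr_sum mulr_sumr big_mkcond /=; apply: ler_sum => s _.
  have m0 : 0 <= deficient_mass s by rewrite fine_ge0.
  case: ifP => [|_]; last by rewrite mulr_ge0.
  rewrite !inE; apply: contraNT; rewrite -ltNge => lt.
  apply: le_trans (expected_loss_le s t0) _; rewrite lee_fin; lra.
have : #|S|%:R + #|~: S|%:R = #|{perm 'I_n * 'I_d}|%:R :> R.
  by rewrite -natrD cardsC.
have : n%:R * \sum_s deficient_mass s <= #|{perm 'I_n * 'I_d}|%:R / n%:R.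
  apply: (@le_trans _ _ (n%:R * (#|{perm 'I_n * 'I_d}|%:R * n%:R ^- 2))).
    by rewrite ler_wpM2l// ltW.
  rewrite le_eqVlt; apply/orP; left; apply/eqP.
  by field; rewrite gt_eqF.
by rewrite mulrBl !mul1r [_^-1 * _]mulrC; lra.
Qed.

End ExpectedLoss.

(** * Choice of the parameters *)

Section Asymptotics.
Variable R : realType.
Implicit Types (x y p eps delta lam t : R) (n d : nat).

Lemma expR_ge_sqr x : 0 <= x -> x ^+ 2 / 2 <= expR x.
Proof. by move=> /(expR_ge1Dxn 1); apply: le_trans; rewrite lerDr. Qed.

Lemma expR_ge_cube x : 0 <= x -> x ^+ 3 / 6 <= expR x.
Proof. by move=> /(expR_ge1Dxn 2); apply: le_trans; rewrite lerDr. Qed.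

Lemma natr_expR_ln n : (0 < n)%N -> n%:R = expR (ln n%:R) :> R.
Proof. by move=> n0; rewrite lnK// posrE ltr0n. Qed.

Lemma invX_expR_ln n k : (0 < n)%N -> n%:R ^- k = expR (- (k%:R * ln n%:R)) :> R.
Proof. by move=> n0; rewrite expRN expRM_natl -natr_expR_ln. Qed.

(** For [y = ln n >= 18] one has [exp y >= y^3 / 6 >= 3 y^2]. *)
Lemma sqr_ln_le n : (0 < n)%N -> 18 <= ln n%:R :> R ->
  3 * ln n%:R ^+ 2 <= n%:R :> R.
Proof.
move=> n0 y18; rewrite [leRHS]natr_expR_ln//; set y := ln _ in y18 *.
have y0 : 0 <= y by apply: le_trans y18.
apply: le_trans (expR_ge_cube y0); rewrite [y ^+ 3]exprSr ler_pdivlMr//.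
by rewrite mulrAC [leLHS]mulrC ler_wpM2l ?sqr_ge0//; lra.
Qed.

Lemma eventually_ln_ge y : exists N, forall n, (N <= n)%N ->
  [/\ (0 < n)%N & y <= ln n%:R :> R].
Proof.
exists (Num.truncn (expR y)).+1 => n Nn.
have n0 : (0 < n)%N by apply: leq_trans Nn.
split=> //; rewrite -[y]expRK ler_ln ?posrE ?expR_gt0 ?ltr0n//.
by apply/ltW/(lt_le_trans (truncnS_gt _)); rewrite ler_nat.
Qed.

Lemma ln_inv_gt0 p : 0 < p < 1 -> 0 < ln (1 / (1 - p)).
Proof.
move=> /andP[p0 p1]; rewrite ln_gt0// div1r invf_gt1 ?subr_gt0//; lra.
Qed.

(** The base equals [(1 - p) (1 + C)] with [C = 2 p / ((1 - p) lam)], and [1 + C <= exp C]. As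
    [C <= ln (1 / (1 - p))], the exponent is monotone in [d]. *)
Lemma base_pow_le p lam d (d0 : R) : 0 < p < 1 -> 0 < lam ->
  2 * p / (1 - p) / lam <= ln (1 / (1 - p)) -> d0 <= d%:R ->
  (1 - p * (1 - 2 / lam)) ^+ d
    <= expR (- (d0 * (ln (1 / (1 - p)) - 2 * p / (1 - p) / lam))).
Proof.
move=> /andP[p0 p1] lam0 hlam d0d; set Lq := ln _ in hlam *; set C := 2 * p / (1 - p) / lam in hlam *.
have q0 : 0 < 1 - p by rewrite subr_gt0.
have qE : 1 - p = expR (- Lq).
  by rewrite expRN lnK ?posrE ?divr_gt0// div1r invrK.
have base0 : 0 <= 1 - p * (1 - 2 / lam).
  have -> : 1 - p * (1 - 2 / lam) = (1 - p) + p * (2 / lam) by ring.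
  by rewrite addr_ge0 ?mulr_ge0 ?invr_ge0// ltW.
have base_le : 1 - p * (1 - 2 / lam) <= expR (- (Lq - C)).
  have -> : 1 - p * (1 - 2 / lam) = (1 - p) * (1 + C).
    by rewrite /C; field; rewrite !gt_eqF.
  by rewrite opprB expRD -qE [leRHS]mulrC ler_pM2l// expR_ge1Dx.
apply: (@le_trans _ _ (expR (- (Lq - C)) ^+ d)).
  by rewrite lerXn2r// nnegrE expR_ge0.
rewrite -expRM_natl ler_expR mulrN lerN2 ler_wpM2r// subr_ge0//.
Qed.

(** Common core of both regimes: [lam0] and [M] depend on [p] alone and settle the medium and large
    sets, leaving the small ones to the choice of [lam] and [t]. *)
Lemma prob_expected_loss p : 0 < p < 1 ->
  exists2 lam0 : R, 2 <= lam0 & exists M, forall lam t n d,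
    lam0 <= lam -> lam <= ln n%:R -> 18 <= ln n%:R :> R -> (M <= n)%N ->
    lam / ln (1 / (1 - p)) <= d%:R -> 1 <= t ->
    (forall a : nat, t < a%:R -> a%:R * lam <= n%:R ->
      (expR 1 * n%:R / a%:R * lam * (1 - p * (1 - 2 / lam)) ^+ d) ^+ a
        <= n%:R ^- 3) ->
    forall mu : demand_distribution R n, demand_class p mu ->
    1 - 1 / n%:R <= configuration_prob R d
      (fun G => (expected_loss mu G <= (2 * t)%:E)%E).
Proof.
move=> p01; have /andP[p0 p1] := p01; have Lq0 := ln_inv_gt0 p01.
set Lq := ln _ in Lq0 *.
pose m := (Num.truncn (1 / p)).+1.
have pm : 1 / p <= m%:R by apply/ltW/truncnS_gt.
pose r := (Num.truncn (expR m.+2%:R * m%:R : R)).+1.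
have hr : expR m.+2%:R * m%:R <= 2 ^+ r :> R.
  apply: (@le_trans _ _ r%:R); first exact/ltW/truncnS_gt.
  by rewrite -natrX ler_nat ltnW// ltn_expl.
pose K := p / (4 * Lq).
have K0 : 0 < K by rewrite divr_gt0// mulr_gt0.
(* The second term forces [d >= lam / Lq >= m + 7 + r]. The third gives [medium_base] through [exp 2
   * lam^2 <= (K lam)^3 / 6 <= exp (K lam)], where [K lam <= p d / 4]. *)
exists (2 + (m + 7 + r)%:R * Lq + 6 * expR 2 / K ^+ 3).
  rewrite -addrA lerDl addr_ge0 ?mulr_ge0 ?invr_ge0 ?exprn_ge0 ?expR_ge0 ?(ltW Lq0)//.
  exact: ltW.
exists (2 * 6`! * m ^ 6)%N => lam t n d lamge lamn n18 Mn dge t1 small mu hmu.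
have t0 : 0 < t by apply: lt_le_trans t1.
have A0 : 0 <= (m + 7 + r)%:R * Lq by rewrite mulr_ge0 ?(ltW Lq0).
have B0 : 0 <= 6 * expR 2 / K ^+ 3.
  by rewrite !mulr_ge0 ?invr_ge0 ?exprn_ge0 ?expR_ge0// ltW.
have lam2 : 2 <= lam by lra.
have lam0 : 0 < lam by lra.
have n0 : (0 < n)%N.
  by rewrite lt0n; apply: contraTneq n18 => ->; rewrite ln0// -ltNge.
apply: configuration_prob_expected_loss => // D D01.
have dge' : (m + 7 + r <= d)%N.
  rewrite -(ler_nat R); apply: le_trans dge; rewrite ler_pdivlMr//; lra.
apply: (prob_deficient p01 t0 lam2 D01 pm dge' hr Mn small).
  apply: (@le_trans _ _ (expR (K * lam))); last first.
    rewrite ler_expR /K; move: dge; rewrite ler_pdivrMr// => dge.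
    have -> : p / (4 * Lq) * lam = p / 4 * (lam / Lq) by field; rewrite gt_eqF.
    have -> : p * d%:R / 4 = p / 4 * d%:R by ring.
    by rewrite ler_wpM2l ?divr_ge0 ?(ltW p0)// ler_pdivrMr.
  apply: (@le_trans _ _ ((K * lam) ^+ 3 / 6)); last first.
    by apply: expR_ge_cube; rewrite mulr_ge0 ?ltW.
  have : 6 * expR 2 / K ^+ 3 <= lam by lra.
  rewrite ler_pdivrMr ?exprn_gt0// => h.
  rewrite ler_pdivlMr// exprMn.
  have -> : K ^+ 3 * lam ^+ 3 = lam * K ^+ 3 * lam ^+ 2 by ring.
  by rewrite mulrAC ler_wpM2r ?sqr_ge0// mulrC.
rewrite invX_expR_ln// ler_expR lerN2 ler_pdivlMr//.
apply: le_trans (sqr_ln_le n0 n18).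
rewrite expr2 mulrA ler_wpM2l// mulr_ge0//; lra.
Qed.

(** Takes [lam = ln (1 / eps)] and [t = eps n / 2]. With [c1 = 2], the power of the base is at most
    [eps * exp (3 C) / lam^2]; against [n / a < 2 / eps] and the factor [lam] this leaves a constant
    over [lam]. *)
Lemma fractional_loss p : 0 < p < 1 ->
  exists eps0 c1 : R, [/\ 0 < eps0, 0 < c1 &
    forall eps : R, 0 < eps < eps0 ->
    exists N : nat, forall n : nat, (N <= n)%N ->
    forall d : nat,
      (ln (1 / eps) + c1 * ln (ln (1 / eps))) / ln (1 / (1 - p)) <= d%:R ->
    forall mu : demand_distribution R n, demand_class p mu ->
      1 - 1 / n%:R <=
        configuration_prob R d
          (fun G => (expected_loss mu G <= (eps * n%:R)%:E)%E)].
Proof.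
move=> p01; have /andP[p0 p1] := p01; have Lq0 := ln_inv_gt0 p01.
have [lam0 lam0_ge2 [M core]] := prob_expected_loss p01.
set Lq := ln (1 / (1 - p)) in Lq0 core *.
pose C := 2 * p / (1 - p) / Lq.
have C0 : 0 < C by rewrite !divr_gt0 ?mulr_gt0 ?subr_gt0.
(* The terms serve the core bound, the hypothesis of [base_pow_le], and the final comparison with
   [exp (- 1)]. *)
pose lam1 := lam0 + C + 2 * expR (2 + 3 * C).
exists (expR (- lam1)), 2; split=> //; first exact: expR_gt0.
move=> eps /andP[eps0 epslt]; set lam := ln (1 / eps).
have epsE : eps = expR (- lam) by rewrite expRN lnK ?posrE ?divr_gt0// div1r invrK.
have lamge : lam1 < lam by move: epslt; rewrite epsE ltr_expR ltrN2.
have e0 : 0 < expR (2 + 3 * C) by rewrite expR_gt0.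
have lam_lam0 : lam0 <= lam by rewrite /lam1 in lamge; lra.
have lam_C : C <= lam by rewrite /lam1 in lamge; lra.
have lam_e : 2 * expR (2 + 3 * C) <= lam by rewrite /lam1 in lamge; lra.
have lam_gt0 : 0 < lam by lra.
have lnlam0 : 0 <= ln lam by rewrite ln_ge0//; lra.
have lnlam : ln lam <= lam by rewrite ltW// ln_sublinear.
(* The term [2 / eps] yields [3 ln n <= eps n / 2 = t], so that [exp (- a) <= n^-3] for [a > t]. *)
have [N hN] := eventually_ln_ge (18 + lam + 2 / eps).
exists (maxn N M) => n; rewrite geq_max => /andP[/hN[n0 nge] Mn] d dge mu hmu.
have nR : 0 < n%:R :> R by rewrite ltr0n.
have eps2 : 0 < 2 / eps by rewrite divr_gt0.
have n18 : 18 <= ln n%:R :> R by lra.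
have t_ge : 3 * ln n%:R <= eps * n%:R / 2.
  rewrite ler_pdivlMr//; apply: (@le_trans _ _ (eps * (3 * ln n%:R ^+ 2))); last first.
    by rewrite ler_pM2l// sqr_ln_le.
  have -> : eps * (3 * ln n%:R ^+ 2) = 3 * ln n%:R * (ln n%:R * eps) by ring.
  rewrite ler_wpM2l//; first by rewrite mulr_ge0//; lra.
  rewrite -ler_pdivrMr//; lra.
have -> : eps * n%:R = 2 * (eps * n%:R / 2) by field.
apply: (core lam) => //; [lra| |lra|].
  apply: le_trans dge; rewrite ler_pM2r ?invr_gt0// lerDl mulr_ge0//.
move=> a ta _; have a0 : 0 < a%:R :> R by apply: lt_trans ta; lra.
have pow : (1 - p * (1 - 2 / lam)) ^+ d <= eps * (expR (3 * C) / lam ^+ 2).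
  have hC : 2 * p / (1 - p) / lam <= Lq.
    by rewrite ler_pdivrMr// [leRHS]mulrC -ler_pdivrMr.
  apply: le_trans (base_pow_le p01 lam_gt0 hC dge) _.
  have -> : eps * (expR (3 * C) / lam ^+ 2) = expR (- lam + 3 * C - 2 * ln lam).
    rewrite !expRD -epsE -mulrA; congr (_ * (_ * _)).
    by rewrite expRN expRM_natl lnK.
  rewrite ler_expR -/Lq.
  have -> : (lam + 2 * ln lam) / Lq * (Lq - 2 * p / (1 - p) / lam)
     = lam + 2 * ln lam - C * (1 + 2 * (ln lam / lam)).
    by rewrite /C; field; rewrite !gt_eqF// subr_gt0.
  have : C * (1 + 2 * (ln lam / lam)) <= C * 3.
    rewrite ler_pM2l//.
    have : ln lam / lam <= 1 by rewrite ler_pdivrMr// mul1r.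
    lra.
  lra.
apply: (@le_trans _ _ (expR (- 1) ^+ a)); last first.
  rewrite -expRM_natl mulrN mulr1 invX_expR_ln// ler_expR lerN2.
  exact: le_trans t_ge (ltW ta).
have base0 : 0 <= 1 - p * (1 - 2 / lam).
  have : 0 <= 2 / lam <= 1 by rewrite divr_ge0 ?(ltW lam_gt0)//= ler_pdivrMr//; lra.
  move=> /andP[h0 h1]; rewrite subr_ge0 mulr_ile1 ?(ltW p0) ?(ltW p1)//; lra.
apply: lerXn2r; rewrite ?nnegrE ?expR_ge0//.
  by rewrite !mulr_ge0 ?expR_ge0 ?invr_ge0 ?exprn_ge0// ltW.
apply: (@le_trans _ _ (expR 1 * (2 / eps) * lam * (eps * (expR (3 * C) / lam ^+ 2)))).
  apply: ler_pM => //; rewrite ?exprn_ge0//.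
    by rewrite !mulr_ge0 ?expR_ge0 ?invr_ge0// ltW.
  rewrite ler_wpM2r ?(ltW lam_gt0)// -mulrA ler_wpM2l ?expR_ge0//.
  rewrite ler_pdivrMr// mulrAC ler_pdivlMr// mulrC; lra.
have -> : expR 1 * (2 / eps) * lam * (eps * (expR (3 * C) / lam ^+ 2))
    = 2 * (expR 1 * expR (3 * C)) / lam.
  by field; rewrite !gt_eqF.
rewrite ler_pdivrMr// -(ler_pM2l (expR_gt0 1)) [leRHS]mulrA -(expRD 1 (-1)) subrr expR0 mul1r.
apply: le_trans lam_e.
have -> : 2 + 3 * C = 1 + (1 + 3 * C) by ring.
by rewrite !expRD; lra.
Qed.

(** Takes [lam = ln n] and [t = l / 2]. The base is at most [K lam n^(- delta) <= n^(- delta / 2)],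
    and [a >= 32 / delta] brings its power below [n^-3]; the term [2 / p] ensures [t >= 1]. *)
Lemma constant_loss p : 0 < p < 1 ->
  forall delta l : R, 0 < delta -> 64 / delta + 2 / p <= l ->
    exists N : nat, forall n : nat, (N <= n)%N ->
    forall d : nat,
      (1 + delta) * ln n%:R / ln (1 / (1 - p)) <= d%:R ->
    forall mu : demand_distribution R n, demand_class p mu ->
      1 - 1 / n%:R <=
        configuration_prob R d
          (fun G => (expected_loss mu G <= l%:E)%E).
Proof.
move=> p01 delta l delta0 lge; have /andP[p0 p1] := p01.
have Lq0 := ln_inv_gt0 p01; have [lam0 lam0_ge2 [M core]] := prob_expected_loss p01.
set Lq := ln (1 / (1 - p)) in Lq0 core *.
pose C := 2 * p / (1 - p) / Lq.
have C0 : 0 < C by rewrite !divr_gt0 ?mulr_gt0 ?subr_gt0.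
pose K := expR (1 + (1 + delta) * C).
have K0 : 0 < K by rewrite expR_gt0.
(* The last term makes [K lam <= (delta lam / 2)^2 / 2 <= exp (delta lam / 2)]. *)
have [N hN] := eventually_ln_ge (18 + lam0 + C + 8 * K / delta ^+ 2).
exists (maxn N M) => n; rewrite geq_max => /andP[/hN[n0 nge] Mn] d dge mu hmu.
set lam := ln n%:R in nge dge.
have KD : 0 < 8 * K / delta ^+ 2 by rewrite divr_gt0 ?exprn_gt0// mulr_gt0.
have lam_K : 8 * K / delta ^+ 2 <= lam by lra.
have lam_C : C <= lam by lra.
have lam_gt0 : 0 < lam by lra.
have p_inv : 1 <= 1 / p by rewrite ler_pdivlMr// mul1r ltW.
have p2 : 2 / p = 2 * (1 / p) by rewrite mul1r.
have D64 : 0 < 32 / delta by rewrite divr_gt0.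
have D64' : 64 / delta = 2 * (32 / delta) by field; rewrite gt_eqF.
have -> : l = 2 * (l / 2) by field.
apply: (core lam) => //; rewrite -/lam; try lra.
  apply: le_trans dge; rewrite ler_pM2r ?invr_gt0// mulrDl mul1r lerDl.
  by rewrite mulr_ge0 ?ltW.
move=> a ta _; have a_ge : 32 / delta <= a%:R by lra.
have a0 : 0 < a%:R :> R by lra.
have pow : (1 - p * (1 - 2 / lam)) ^+ d <= expR (- ((1 + delta) * (lam - C))).
  have hC : 2 * p / (1 - p) / lam <= Lq.
    by rewrite ler_pdivrMr// [leRHS]mulrC -ler_pdivrMr.
  apply: le_trans (base_pow_le p01 lam_gt0 hC dge) _.
  rewrite ler_expR lerN2 -/Lq.
  have -> // : (1 + delta) * lam / Lq * (Lq - 2 * p / (1 - p) / lam)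
     = (1 + delta) * (lam - C).
  by rewrite /C; field; rewrite !gt_eqF// subr_gt0.
have base0 : 0 <= 1 - p * (1 - 2 / lam).
  have : 0 <= 2 / lam <= 1 by rewrite divr_ge0 ?(ltW lam_gt0)//= ler_pdivrMr//; lra.
  move=> /andP[h0 h1]; rewrite subr_ge0 mulr_ile1 ?(ltW p0) ?(ltW p1)//; lra.
apply: (@le_trans _ _ (expR (- (delta / 2 * lam)) ^+ a)); last first.
  rewrite -expRM_natl invX_expR_ln// -/lam mulrN ler_expR lerN2 mulrA.
  rewrite ler_pM2r//; move: a_ge; rewrite ler_pdivrMr//; lra.
apply: lerXn2r; rewrite ?nnegrE ?expR_ge0//.
  by rewrite !mulr_ge0 ?expR_ge0 ?invr_ge0 ?exprn_ge0// ltW.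
apply: (@le_trans _ _ (expR 1 * expR lam * lam * expR (- ((1 + delta) * (lam - C))))).
  apply: ler_pM => //; rewrite ?exprn_ge0//.
    by rewrite !mulr_ge0 ?expR_ge0 ?invr_ge0// ltW.
  rewrite ler_wpM2r ?(ltW lam_gt0)// -mulrA ler_wpM2l ?expR_ge0//.
  rewrite /lam -natr_expR_ln// ler_pdivrMr// ler_peMr// ler1n.
  by rewrite -(ltr0n R).
have -> : expR 1 * expR lam * lam * expR (- ((1 + delta) * (lam - C)))
    = K * lam * expR (- (delta * lam)).
  rewrite mulrAC -!expRD [RHS]mulrAC /K -expRD; congr (expR _ * _); ring.
have -> : - (delta * lam) = - (delta / 2 * lam) + - (delta / 2 * lam) by field.
rewrite expRD mulrA ger_pMl ?expR_gt0// expRN ler_pdivrMr ?expR_gt0// mul1r.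
have h0 : 0 <= delta / 2 * lam by rewrite mulr_ge0 ?divr_ge0 ?ltW.
apply: le_trans (expR_ge_sqr h0).
move: lam_K; rewrite ler_pdivrMr ?exprn_gt0// => lam_K.
have -> : (delta / 2 * lam) ^+ 2 / 2 = lam * delta ^+ 2 / 8 * lam by field.
by rewrite ler_wpM2r ?(ltW lam_gt0)// ler_pdivlMr//; lra.
Qed.

End Asymptotics.

Theorem theorem3p4 (R : realType) (p : R) (hp : 0 < p < 1) :
  let q := 1 - p in
  (exists eps0 c1 : R, [/\ 0 < eps0, 0 < c1 &
    forall eps : R, 0 < eps < eps0 ->
    exists N : nat, forall n : nat, (N <= n)%N ->
    forall d : nat,
      (ln (1 / eps) + c1 * ln (ln (1 / eps))) / ln (1 / q) <= d%:R ->
    forall mu : demand_distribution R n, demand_class p mu ->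
      1 - 1 / n%:R <=
        configuration_prob R d
          (fun G => (expected_loss mu G <= (eps * n%:R)%:E)%E)])
  /\
  (forall delta l : R, 0 < delta -> 64 / delta + 2 / p <= l ->
    exists N : nat, forall n : nat, (N <= n)%N ->
    forall d : nat,
      (1 + delta) * ln n%:R / ln (1 / q) <= d%:R ->
    forall mu : demand_distribution R n, demand_class p mu ->
      1 - 1 / n%:R <=
        configuration_prob R d
          (fun G => (expected_loss mu G <= l%:E)%E)).
Proof. by split; [exact: fractional_loss|exact: constant_loss]. Qed.
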